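(* Let $g$ and $h$ be elements of $Sp(n,1)$ such that $g$ is loxodromic with fixed points $u,v\in\partial H_{\mathbb H}^n$. If either $$M_g\bigl(1+|[h(u),v,u,h(v)]|^{1/2}\bigr)<1\quad\text{or}\quad M_g\bigl(1+|[h(u),u,v,h(v)]|^{1/2}\bigr)<1,$$ then the subgroup $\langle g,h\rangle$ of $Sp(n,1)$ generated by $g$ and $h$ is either elementary or not discrete.
   Context: Let $n\ge 1$ and let $\mathbb H$ be the division ring of real quaternions, with conjugation $z\mapsto\overline z$ and modulus $|z|=\sqrt{\overline z z}$. Let $\mathbb H^{n,1}$ be the right quaternionic vector space of column vectors with $n+1$ quaternionic entries, equipped with the Hermitian form $$\langle \mathbf z,\mathbf w\rangle=\mathbf w^*J\mathbf z=\overline{w_1}z_1+\cdots+\overline{w_{n-1}}z_{n-1}-(\overline{w_n}z_{n+1}+\overline{w_{n+1}}z_n),\qquad J=\begin{pmatrix} I_{n-1}&0&0\\0&0&-1\\0&-1&0\end{pmatrix},$$ where $*$ is the quaternionic conjugate transpose. $Sp(n,1)$ is the group of $(n+1)\times(n+1)$ quaternionic matrices $g$ with $g^*Jg=J$ (acting on column vectors by left multiplication), with its usual topology as a matrix group; discreteness refers to this topology. Let $V_-=\{\mathbf z:\langle\mathbf z,\mathbf z\rangle<0\}$ and $V_0=\{\mathbf z\neq0:\langle\mathbf z,\mathbf z\rangle=0\}$, and let $P$ be the projection to right projective space (identifying $\mathbf z$ with $\mathbf z q$ for $q\in\mathbb H\setminus\{0\}$). Quaternionic hyperbolic $n$-space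 is $H_{\mathbb H}^n=P(V_-)$, its boundary is $\partial H_{\mathbb H}^n=P(V_0)$, and $\overline{H_{\mathbb H}^n}=H_{\mathbb H}^n\cup\partial H_{\mathbb H}^n$. $Sp(n,1)$ acts on $\overline{H_{\mathbb H}^n}$. A non-trivial $g\in Sp(n,1)$ is *elliptic* if it has a fixed point in $H_{\mathbb H}^n$, *parabolic* if it has exactly one fixed point, which lies in $\partial H_{\mathbb H}^n$, and *loxodromic* if it has exactly two fixed points, which lie in $\partial H_{\mathbb H}^n$. A subgroup $G$ of $Sp(n,1)$ is *non-elementary* if it contains two non-elliptic elements of infinite order with distinct fixed points; otherwise it is *elementary*. For a subgroup $G$ containing a loxodromic element (as $\langle g,h\rangle$ does), $G$ is elementary if and only if it fixes a point of $\partial H_{\mathbb H}^n$ or leaves invariant a pair of points $\{x,y\}\subset\partial H_{\mathbb H}^n$. Every loxodromic $g\in Sp(n,1)$ is conjugate in $Sp(n,1)$ to a diagonal matrix $\mathrm{diag}(\lambda_1,\dots,\lambda_{n+1})$ with $|\lambda_i|=1$ for $1\le i\le n-1$, $|\lambda_n|\ne1$ and $\overline{\lambda_n}\lambda_{n+1}=1$ (the $\lambda_i$ are right eigenvalues of $g$). Define $$\delta(g)=\max_{1\le i\le n-1}|\lambda_i-1|,\qquad M_g=2\delta(g)+|\lambda_n-1|+|\lambda_{n+1}-1|$$ (with $\delta(g)=0$ if $n=1$); these numbers depend only on the conjugacy class of $g$. The quaternionic cross-ratio of points $z_1,z_2,w_1,w_2\in\overline{H_{\mathbb H}^n}$ is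 $$[z_1,z_2,w_1,w_2]=\langle\mathbf w_1,\mathbf z_1\rangle\langle\mathbf w_1,\mathbf z_2\rangle^{-1}\langle\mathbf w_2,\mathbf z_2\rangle\langle\mathbf w_2,\mathbf z_1\rangle^{-1},$$ where $\mathbf z_i\in P^{-1}(z_i)$, $\mathbf w_i\in P^{-1}(w_i)$. Its absolute value $$|[z_1,z_2,w_1,w_2]|=\frac{|\langle\mathbf w_1,\mathbf z_1\rangle\langle\mathbf w_2,\mathbf z_2\rangle|}{|\langle\mathbf w_1,\mathbf z_2\rangle\langle\mathbf w_2,\mathbf z_1\rangle|}$$ is independent of the choice of lifts. *)

(* Defs.v *)
From HB Require Import structures.
From mathcomp Require Import all_boot all_order all_algebra.
From mathcomp Require Import all_classical all_reals all_analysis.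
From mathcomp Require Import ring lra.

Set Implicit Arguments.
Unset Strict Implicit.
Unset Printing Implicit Defensive.

Import Order.TTheory GRing.Theory Num.Theory numFieldNormedType.Exports.

Local Open Scope classical_set_scope.
Local Open Scope ring_scope.

Record quat (R : Type) := Quat { qre : R; qi : R; qj : R; qk : R }.

Definition quat_prod (R : Type) (x : quat R) : R * R * R * R :=
  (qre x, qi x, qj x, qk x).

Definition prod_quat (R : Type) (x : R * R * R * R) : quat R :=
  let: (a, b, c, d) := x in Quat a b c d.

Lemma quat_prodK (R : Type) : cancel (@quat_prod R) (@prod_quat R).
Proof. by case. Qed.

HB.instance Definition _ (R : choiceType) :=
  Choice.copy (quat R) (can_type (@quat_prodK R)).

Section QuatRing.
Variable R : realType.
Local Notation H := (quat R).
Implicit Types x y z : H.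

Lemma quat_ext x y : qre x = qre y -> qi x = qi y -> qj x = qj y ->
  qk x = qk y -> x = y.
Proof. by case: x y => a b c d [a' b' c' d'] /= -> -> -> ->. Qed.

Definition quat_zero : H := Quat 0 0 0 0.

Definition quat_opp x : H := Quat (- qre x) (- qi x) (- qj x) (- qk x).

Definition quat_add x y : H :=
  Quat (qre x + qre y) (qi x + qi y) (qj x + qj y) (qk x + qk y).

Lemma quat_addA : associative quat_add.
Proof. by move=> x y z; apply: quat_ext; rewrite /= addrA. Qed.

Lemma quat_addC : commutative quat_add.
Proof. by move=> x y; apply: quat_ext; rewrite /= addrC. Qed.

Lemma quat_add0 : left_id quat_zero quat_add.
Proof. by move=> x; apply: quat_ext; rewrite /= add0r. Qed.

Lemma quat_addN : left_inverse quat_zero quat_opp quat_add.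
Proof. by move=> x; apply: quat_ext; rewrite /= addNr. Qed.

HB.instance Definition _ :=
  GRing.isZmodule.Build H quat_addA quat_addC quat_add0 quat_addN.

Definition quat_one : H := Quat 1 0 0 0.

Definition quat_mul x y : H :=
  Quat (qre x * qre y - qi x * qi y - qj x * qj y - qk x * qk y)
       (qre x * qi y + qi x * qre y + qj x * qk y - qk x * qj y)
       (qre x * qj y - qi x * qk y + qj x * qre y + qk x * qi y)
       (qre x * qk y + qi x * qj y - qj x * qi y + qk x * qre y).

Lemma quat_mulA : associative quat_mul.
Proof. by move=> x y z; apply: quat_ext => /=; ring. Qed.

Lemma quat_mul1l : left_id quat_one quat_mul.
Proof. by move=> x; apply: quat_ext => /=; ring. Qed.

Lemma quat_mul1r : right_id quat_one quat_mul.
Proof. by move=> x; apply: quat_ext => /=; ring. Qed.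

Lemma quat_mulDl : left_distributive quat_mul +%R.
Proof. by move=> x y z; apply: quat_ext => /=; ring. Qed.

Lemma quat_mulDr : right_distributive quat_mul +%R.
Proof. by move=> x y z; apply: quat_ext => /=; ring. Qed.

Lemma quat_one_neq0 : quat_one != 0.
Proof. by apply/eqP => -[/eqP]; rewrite oner_eq0. Qed.

HB.instance Definition _ := GRing.Zmodule_isNzRing.Build H
  quat_mulA quat_mul1l quat_mul1r quat_mulDl quat_mulDr quat_one_neq0.

Definition qconj x : H := Quat (qre x) (- qi x) (- qj x) (- qk x).

Definition qabs x : R := Num.sqrt (qre (qconj x * x)).

Definition qnorm2 x : R := qre x ^+ 2 + qi x ^+ 2 + qj x ^+ 2 + qk x ^+ 2.

Lemma qnorm2_neq0 x : x != 0 -> qnorm2 x != 0.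
Proof.
apply: contraNneq; rewrite /qnorm2 => /eqP.
rewrite !paddr_eq0 ?addr_ge0 ?sqr_ge0 // !sqrf_eq0.
by move=> /andP[/andP[/andP[/eqP ? /eqP ?] /eqP ?] /eqP ?]; apply/eqP/quat_ext.
Qed.

Definition quat_inv x : H :=
  Quat (qre x / qnorm2 x) (- qi x / qnorm2 x)
       (- qj x / qnorm2 x) (- qk x / qnorm2 x).

Definition quat_unit : pred H := [pred x | x != 0].

Lemma quat_mulVr : {in quat_unit, left_inverse 1 quat_inv *%R}.
Proof.
move=> x /qnorm2_neq0 n0; apply: quat_ext => /=; last 3 first.
- by field.
- by field.
- by field.
by rewrite /qnorm2 in n0 *; field.
Qed.

Lemma quat_divrr : {in quat_unit, right_inverse 1 quat_inv *%R}.
Proof.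
move=> x /qnorm2_neq0 n0; apply: quat_ext => /=; last 3 first.
- by field.
- by field.
- by field.
by rewrite /qnorm2 in n0 *; field.
Qed.

Lemma quat_unitP x y : y * x = 1 /\ x * y = 1 -> quat_unit x.
Proof.
case=> + _; apply: contra_eqN => /eqP ->.
by rewrite mulr0 eq_sym oner_eq0.
Qed.

Lemma quat_inv_out : {in [predC quat_unit], quat_inv =1 id}.
Proof.
move=> x; rewrite !inE negbK => /eqP ->.
by apply: quat_ext; rewrite /= ?oppr0 mul0r.
Qed.

HB.instance Definition _ := GRing.NzRing_hasMulInverse.Build H
  quat_mulVr quat_divrr quat_unitP quat_inv_out.

(* the topology of R^4 *)
HB.instance Definition _ :=
  PseudoMetric.copy H (initial_topology (@quat_prod R)).

Lemma qconjD x y : qconj (x + y) = qconj x + qconj y.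
Proof. by apply: quat_ext => /=; ring. Qed.

Lemma qconjM x y : qconj (x * y) = qconj y * qconj x.
Proof. by apply: quat_ext => /=; ring. Qed.

Lemma qconjK : involutive qconj.
Proof. by move=> x; apply: quat_ext; rewrite /= ?opprK. Qed.

End QuatRing.

Definition adjmx (R : realType) (m n : nat) (A : 'M[quat R]_(m, n)) :
  'M[quat R]_(n, m) := (map_mx (@qconj R) A)^T.

Section AdjMx.
Variable R : realType.
Local Notation H := (quat R).

Lemma qconj_sum (I : finType) (F : I -> H) :
  qconj (\sum_i F i) = \sum_i qconj (F i).
Proof.
apply: (big_morph _ (@qconjD R)).
by apply: quat_ext; rewrite /= ?oppr0.
Qed.

Lemma adjmxM m n p (A : 'M[H]_(m, n)) (B : 'M[H]_(n, p)) :
  adjmx (A *m B) = adjmx B *m adjmx A.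
Proof.
apply/matrixP => i j; rewrite !mxE qconj_sum.
by apply: eq_bigr => k _; rewrite !mxE qconjM.
Qed.

Lemma adjmxK m n : cancel (@adjmx R m n) (@adjmx R n m).
Proof. by move=> A; apply/matrixP => i j; rewrite !mxE qconjK. Qed.

Lemma adjmx1 n : adjmx (1%:M : 'M[H]_n) = 1%:M.
Proof.
apply/matrixP => i j; rewrite !mxE eq_sym.
by case: eqP => _; apply: quat_ext; rewrite /= ?oppr0.
Qed.

(* left multiplication by [A] as a real matrix, in the basis 1, i, j, k *)
Definition realmx n (A : 'M[H]_n) : 'M[R]_(n + n + (n + n)) :=
  let a := map_mx (@qre R) A in let b := map_mx (@qi R) A in
  let c := map_mx (@qj R) A in let d := map_mx (@qk R) A in
  block_mx (block_mx a (- b) b a) (block_mx (- c) (- d) (- d) c)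
           (block_mx c d d (- c)) (block_mx a (- b) b a).

Lemma realmx_inj n : injective (@realmx n).
Proof.
move=> A B /eq_block_mx[/eq_block_mx[/matrixP ea _ /matrixP eb _] _].
move=> /eq_block_mx[/matrixP ec /matrixP ed _ _] _.
apply/matrixP => i j; apply: quat_ext.
- by have := ea i j; rewrite !mxE.
- by have := eb i j; rewrite !mxE.
- by have := ec i j; rewrite !mxE.
- by have := ed i j; rewrite !mxE.
Qed.

Lemma realmx1 n : realmx (1%:M : 'M[H]_n) = 1%:M.
Proof.
have -> : (1%:M : 'M[R]_(n + n + (n + n))) =
    block_mx (block_mx 1%:M 0 0 1%:M) 0 0 (block_mx 1%:M 0 0 1%:M).
  by rewrite -!scalar_mx_block.
rewrite /realmx.
have -> : map_mx (@qre R) (1%:M : 'M[H]_n) = 1%:M.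
  by apply/matrixP => i j; rewrite !mxE; case: eqP.
have -> : map_mx (@qi R) (1%:M : 'M[H]_n) = 0.
  by apply/matrixP => i j; rewrite !mxE; case: eqP.
have -> : map_mx (@qj R) (1%:M : 'M[H]_n) = 0.
  by apply/matrixP => i j; rewrite !mxE; case: eqP.
have -> : map_mx (@qk R) (1%:M : 'M[H]_n) = 0.
  by apply/matrixP => i j; rewrite !mxE; case: eqP.
by rewrite !oppr0 !block_mx0.
Qed.

Lemma realmxM n (A B : 'M[H]_n) : realmx (A *m B) = realmx A *m realmx B.
Proof.
rewrite /realmx.
set a := map_mx (@qre R) A; set b := map_mx (@qi R) A.
set c := map_mx (@qj R) A; set d := map_mx (@qk R) A.
set a' := map_mx (@qre R) B; set b' := map_mx (@qi R) B.
set c' := map_mx (@qj R) B; set d' := map_mx (@qk R) B.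
have -> : map_mx (@qre R) (A *m B) =
    a *m a' - b *m b' - c *m c' - d *m d'.
  apply/matrixP => i j; rewrite !mxE (big_morph (@qre R) (id1 := 0) (op1 := +%R)) //.
  rewrite -!sumrB; apply: eq_bigr => k _; by rewrite !mxE.
have -> : map_mx (@qi R) (A *m B) =
    a *m b' + b *m a' + c *m d' - d *m c'.
  apply/matrixP => i j; rewrite !mxE (big_morph (@qi R) (id1 := 0) (op1 := +%R)) //.
  rewrite -!big_split -sumrB; apply: eq_bigr => k _; by rewrite !mxE.
have -> : map_mx (@qj R) (A *m B) =
    a *m c' - b *m d' + c *m a' + d *m b'.
  apply/matrixP => i j; rewrite !mxE (big_morph (@qj R) (id1 := 0) (op1 := +%R)) //.
  rewrite -sumrB -!big_split; apply: eq_bigr => k _; by rewrite !mxE.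
have -> : map_mx (@qk R) (A *m B) =
    a *m d' + b *m c' - c *m b' + d *m a'.
  apply/matrixP => i j; rewrite !mxE (big_morph (@qk R) (id1 := 0) (op1 := +%R)) //.
  rewrite -big_split -sumrB -big_split; apply: eq_bigr => k _; by rewrite !mxE.
rewrite !mulmx_block !add_block_mx !(mulmxN, mulNmx) !opprK.
move: (a *m a') (a *m b') (a *m c') (a *m d').
move: (b *m a') (b *m b') (b *m c') (b *m d').
move: (c *m a') (c *m b') (c *m c') (c *m d').
move: (d *m a') (d *m b') (d *m c') (d *m d').
clear=> *; congr block_mx; congr block_mx;
  by apply/matrixP => i j; rewrite !mxE; ring.
Qed.

Lemma quatmx1C n (A B : 'M[H]_n) : A *m B = 1%:M -> B *m A = 1%:M.
Proof.
move=> AB; apply: realmx_inj; rewrite realmxM realmx1.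
by apply: mulmx1C; rewrite -realmxM AB realmx1.
Qed.

End AdjMx.

(* The dimension n >= 1 is [p.+1], so column vectors have [p.+2] entries; the
   1-based indices 1..n-1, n and n+1 are the ordinals [i < p], [pen_ord p] and
   [ord_max]. *)
Definition pen_ord (p : nat) : 'I_p.+2 := inord p.

Definition formmx (R : realType) (p : nat) : 'M[quat R]_p.+2 :=
  \matrix_(i, j)
    if (i < p)%N && (i == j) then 1
    else if (i == pen_ord p) && (j == ord_max) ||
            (i == ord_max) && (j == pen_ord p) then -1
    else 0.

Record Sp (R : realType) (p : nat) := MkSp {
  sp_val :> 'M[quat R]_p.+2;
  spP : adjmx sp_val *m formmx R p *m sp_val == formmx R p
}.

HB.instance Definition _ (R : realType) (p : nat) :=
  [isSub for @sp_val R p].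
HB.instance Definition _ (R : realType) (p : nat) :=
  [Choice of Sp R p by <:].

Section SpGroup.
Variables (R : realType) (p : nat).
Local Notation J := (formmx R p).
Local Notation Sp := (Sp R p).
Implicit Types g h : Sp.

Let sigma (i : 'I_p.+2) : 'I_p.+2 :=
  if (i < p)%N then i else if i == pen_ord p then ord_max else pen_ord p.

Let pen_ordE : val (pen_ord p) = p.
Proof. by rewrite /= inordK. Qed.

Let sigmaK : involutive sigma.
Proof.
move=> i; rewrite /sigma; case ip: (i < p)%N; first by rewrite ip.
case: eqP => [->|/eqP ipen] /=.
  by rewrite ltnNge leqnSn /= -val_eqE pen_ordE /= gtn_eqF.
rewrite inordK // ltnn eqxx; apply/val_inj => /=; apply/esym/eqP.
rewrite eqn_leq -ltnS ltn_ord /= ltn_neqAle leqNgt ip andbT.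
by move: ipen; rewrite eq_sym -val_eqE pen_ordE.
Qed.

Let formmxE i j : J i j = (if (i < p)%N then 1 else -1) *+ (j == sigma i).
Proof.
rewrite mxE /sigma; have [ip|pi] := ltnP i p.
  rewrite eq_sym; case: eqP => [->|_] //=.
  have /negPf -> : i != pen_ord p by rewrite -val_eqE pen_ordE neq_ltn ip.
  have /negPf -> // : i != ord_max by rewrite -val_eqE neq_ltn leqW.
have [->|ipen] := eqVneq i (pen_ord p).
  rewrite /= -[pen_ord p == ord_max]val_eqE pen_ordE /= ltn_eqF //= orbF.
  by case: eqP.
have -> /= : i = ord_max.
  apply/val_inj/eqP; rewrite /= eqn_leq -ltnS ltn_ord /= ltn_neqAle pi andbT.
  by move: ipen; rewrite eq_sym -val_eqE pen_ordE.
by rewrite eqxx; case: eqP.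
Qed.

Lemma adj_formmx : adjmx J = J.
Proof.
apply/matrixP => i j; rewrite !mxE [j == i]eq_sym [_ && _ || _]orbC.
rewrite [(j == _) && _]andbC [(j == pen_ord p) && _]andbC.
have -> : (j < p)%N && (i == j) = (i < p)%N && (i == j).
  by case: (i =P j) => [->|]; rewrite ?andbF.
by case: ifP => _; last case: ifP => _; apply: quat_ext; rewrite /= ?oppr0.
Qed.

Lemma formmxK : J *m J = 1%:M.
Proof.
apply/matrixP => i k; rewrite [LHS]mxE (bigD1 (sigma i)) //= big1 => [|j /negPf jk].
  rewrite !formmxE sigmaK eqxx [RHS]mxE [k == i]eq_sym mulr1n addr0 mulrnAr.
  congr (_ *+ _); rewrite /sigma.
  case: ifP => [ip|ip]; first by rewrite ip mulr1.
  case: eqP => _ /=; first by rewrite ltnNge leqnSn mulrNN mulr1.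
  by rewrite inordK // ltnn mulrNN mulr1.
by rewrite formmxE jk mul0r.
Qed.

Fact Sp_one_subproof : adjmx 1%:M *m J *m 1%:M == J.
Proof. by rewrite adjmx1 mul1mx mulmx1. Qed.

Definition Sp_one : Sp := MkSp Sp_one_subproof.

Fact Sp_mul_subproof g h : adjmx (g *m h) *m J *m (g *m h) == J.
Proof.
rewrite adjmxM -!mulmxA [adjmx g *m _]mulmxA [adjmx g *m _ *m _]mulmxA.
by rewrite (eqP (spP g)) mulmxA; exact: spP.
Qed.

Definition Sp_mul g h : Sp := MkSp (Sp_mul_subproof g h).

Let Sp_mulVmx g : J *m adjmx g *m J *m g = 1%:M.
Proof. by rewrite -!mulmxA [adjmx g *m _]mulmxA (eqP (spP g)) formmxK. Qed.

Fact Sp_inv_subproof g :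
  adjmx (J *m adjmx g *m J) *m J *m (J *m adjmx g *m J) == J.
Proof.
rewrite !adjmxM adj_formmx adjmxK -!mulmxA [J *m (J *m _)]mulmxA formmxK mul1mx.
by rewrite [J *m (adjmx g *m J)]mulmxA (quatmx1C (Sp_mulVmx g)) mulmx1.
Qed.

Definition Sp_inv g : Sp := MkSp (Sp_inv_subproof g).

Lemma Sp_mulA : associative Sp_mul.
Proof. by move=> g h k; apply/val_inj; rewrite /= mulmxA. Qed.

Lemma Sp_mul1g : left_id Sp_one Sp_mul.
Proof. by move=> g; apply/val_inj; rewrite /= mul1mx. Qed.

Lemma Sp_mulg1 : right_id Sp_one Sp_mul.
Proof. by move=> g; apply/val_inj; rewrite /= mulmx1. Qed.

Lemma Sp_mulVg : left_inverse Sp_one Sp_inv Sp_mul.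
Proof. by move=> g; apply/val_inj; exact: Sp_mulVmx. Qed.

Lemma Sp_mulgV : right_inverse Sp_one Sp_inv Sp_mul.
Proof. by move=> g; apply/val_inj; exact/quatmx1C/Sp_mulVmx. Qed.

HB.instance Definition _ := isGroup.Build Sp
  Sp_mulA Sp_mul1g Sp_mulg1 Sp_mulVg Sp_mulgV.

End SpGroup.

Section HyperbolicSpace.
Variables (R : realType) (p : nat).
Local Notation H := (quat R).
Local Notation V := ('cV[quat R]_p.+2).
Local Notation Sp := (Sp R p).

Definition herm (z w : V) : H := (adjmx w *m formmx R p *m z) 0 0.

(* [herm z z] has no imaginary part *)
Definition Vneg : set V := [set z | qre (herm z z) < 0].

Definition Vnull : set V := [set z | z != 0 /\ herm z z = 0].

(* A point of the right projective space is the set of its lifts. *)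
Definition projpt (z : V) : set V := [set z *m q%:M | q in [set q : H | q != 0]].

Definition hyp : set (set V) := projpt @` Vneg.

Definition bdry : set (set V) := projpt @` Vnull.

Definition hypbar : set (set V) := hyp `|` bdry.

Definition Sp_act (g : Sp) (x : set V) : set V := mulmx (sp_val g) @` x.

Definition fixpts (g : Sp) : set (set V) := [set x | hypbar x /\ Sp_act g x = x].

Definition elliptic (g : Sp) : Prop :=
  g <> 1%g /\ exists2 x, hyp x & Sp_act g x = x.

Definition loxodromic (g : Sp) : Prop :=
  g <> 1%g /\
  exists u v, [/\ bdry u, bdry v, u <> v & fixpts g = [set u; v]].

Definition infinite_order (g : Sp) : Prop :=
  forall k : nat, (0 < k)%N -> (g ^+ k)%g <> 1%g.

Definition gen2 (g h : Sp) : set Sp :=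
  [set x | forall G : set Sp, group_closed [in G] -> G g -> G h -> G x].

(* "Distinct fixed points" means that the two elements have no common fixed
   point; only with this reading is a group that contains a loxodromic element
   and fixes a boundary point always elementary. *)
Definition nonelementary (G : set Sp) : Prop :=
  exists f g : Sp, [/\ G f /\ G g, ~ elliptic f /\ ~ elliptic g,
    infinite_order f /\ infinite_order g & fixpts f `&` fixpts g = set0].

Definition elementary (G : set Sp) : Prop := ~ nonelementary G.

Definition discrete (G : set Sp) : Prop :=
  let GM := @sp_val R p @` G in GM `<=` isolated GM.

Definition diag_form (g : Sp) (l : 'rV[H]_p.+2) : Prop :=
  [/\ exists a : Sp, sp_val (a * g * a^-1)%g = diag_mx l,
      forall i : 'I_p.+2, (i < p)%N -> qabs (l 0 i) = 1,
      qabs (l 0 (pen_ord p)) <> 1 &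
      qconj (l 0 (pen_ord p)) * l 0 ord_max = 1].

(* Every loxodromic element has a diagonal form, and all its diagonal forms
   yield the same value of [Mg]. *)
Definition eigs (g : Sp) : 'rV[H]_p.+2 := xget 0 [set l | diag_form g l].

Definition delta (g : Sp) : R :=
  \big[Num.max/0]_(i < p.+2 | (i < p)%N) qabs (eigs g 0 i - 1).

Definition Mg (g : Sp) : R :=
  2 * delta g + qabs (eigs g 0 (pen_ord p) - 1) + qabs (eigs g 0 ord_max - 1).

Definition lift_pt (x : set V) : V := xget 0 x.

(* only the absolute value is independent of the lifts *)
Definition cross_ratio (z1 z2 w1 w2 : set V) : H :=
  let Z1 := lift_pt z1 in let Z2 := lift_pt z2 in
  let W1 := lift_pt w1 in let W2 := lift_pt w2 in
  herm W1 Z1 * (herm W1 Z2)^-1 * herm W2 Z2 * (herm W2 Z1)^-1.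

End HyperbolicSpace.

(* Main.v *)
(* Conjugate [g] to a diagonal matrix [D]; its fixed points become the lines
   spanned by the last two basis vectors, and the absolute cross-ratios become
   |bc| and |ad| for the corner entries a, b, c, d of [h].  Iterate
   [h_(k+1) = h_k g h_k^-1].  Expanding the corner entries and using that the
   last two rows of [h_k] are null vectors gives |b'| <= M |a||b| and
   |c'| <= M |c||d|, while the triangle inequality for the Cygan metric gives
   |ad|^(1/2) <= 1 + |bc|^(1/2) and the same with the two products exchanged.
   Hence |bc| decays geometrically, and the conjugates of [h_2k] by powers of
   [g] stay bounded while b and c tend to 0.  In a discrete group a bounded set
   is finite, so b = c = 0 for some k; then [h_2k] preserves the pair of fixed
   points of [g], and this property descends from [h_(k+1)] to [h_k].
   Non-elliptic elements that preserve the pair fix both of its points. *)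

Require Import Defs.
From HB Require Import structures.
From mathcomp Require Import all_boot all_order all_algebra.
From mathcomp Require Import all_classical all_reals all_analysis.
From mathcomp Require Import ring lra.

Import Order.TTheory GRing.Theory Num.Theory numFieldNormedType.Exports.

Local Open Scope classical_set_scope.
Local Open Scope ring_scope.

Set Implicit Arguments.
Unset Strict Implicit.
Unset Printing Implicit Defensive.

(** * The modulus on the quaternions *)

(** Why [M_g] governs the iteration: up to sign, the entries b' and c' of [h_k g h_k^-1] are values
    of the Hermitian form on a null row of [h_k] paired with itself, weighted by the eigenvalues of
    [g]. If all weights were 1 the value would be 0, so only the differences between the eigenvalues
    and 1 contribute. The two hypotheses merge after one step: either of them forces M (1 +
    |bc|^(1/2)) < 1 for [h_1]. The obstacle is that b and c need not tend to 0 separately. With r =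
    |lambda_n|, the entries |a| and |d| are bounded only by about r and 1/r, so the estimates give
    growth rates M r for b and M / r for c, and one of these may exceed 1. Passing from [h_2k] to
    [g^-k h_2k g^k] divides |b| by r^(2k), multiplies |c| by r^(2k) and keeps |a| and |d|. This
    cancels the powers of r exactly, which is why even indices are used, and leaves a decay governed
    by M < 1. Norms are measured on [a x a^-1], where [a] diagonalizes [g], while discreteness is
    used for the original group, so the group itself is never conjugated. *)

Section Modulus.
Variable R : realType.
Local Notation H := (quat R).
Implicit Types x y : H.

Lemma qnorm2_ge0 x : 0 <= qnorm2 x.
Proof. by rewrite /qnorm2 !addr_ge0 ?sqr_ge0. Qed.

Lemma qabsE x : qabs x = Num.sqrt (qnorm2 x).
Proof. by rewrite /qabs /qnorm2 /=; congr Num.sqrt; ring. Qed.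

Lemma qabs_ge0 x : 0 <= qabs x.
Proof. by rewrite qabsE sqrtr_ge0. Qed.

Lemma qabs_sqr x : qabs x ^+ 2 = qnorm2 x.
Proof. by rewrite qabsE sqr_sqrtr ?qnorm2_ge0. Qed.

Lemma qabs0 : qabs (0 : H) = 0.
Proof. by rewrite qabsE /qnorm2 /= !expr0n /= !addr0 sqrtr0. Qed.

Lemma qabs1 : qabs (1 : H) = 1.
Proof. by rewrite qabsE /qnorm2 /= expr1n !expr0n /= !addr0 sqrtr1. Qed.

Lemma qabs_eq0 x : (qabs x == 0) = (x == 0).
Proof.
apply/idP/eqP => [|->]; last by rewrite qabs0.
rewrite -sqrf_eq0 qabs_sqr; apply: contraTeq; exact: qnorm2_neq0.
Qed.

Lemma qabsN x : qabs (- x) = qabs x.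
Proof. by rewrite !qabsE /qnorm2 /= !sqrrN. Qed.

Lemma qabs_conj x : qabs (qconj x) = qabs x.
Proof. by rewrite !qabsE /qnorm2 /= !sqrrN. Qed.

Lemma qabsM x y : qabs (x * y) = qabs x * qabs y.
Proof.
rewrite !qabsE -sqrtrM ?qnorm2_ge0//; congr Num.sqrt.
by rewrite /qnorm2 /=; ring.
Qed.

Lemma qabsV x : qabs x^-1 = (qabs x)^-1.
Proof.
have [->|x0] := eqVneq x 0; first by rewrite invr0 qabs0 invr0.
have a0 : qabs x != 0 by rewrite qabs_eq0.
apply: (mulfI a0); rewrite -qabsM mulfV// divrr ?qabs1//.
Qed.

Lemma ler_qre x : `|qre x| <= qabs x.
Proof.
rewrite qabsE -sqrtr_sqr ler_sqrt ?qnorm2_ge0// /qnorm2.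
by rewrite -!addrA lerDl !addr_ge0 ?sqr_ge0.
Qed.

Lemma ler_qabsD x y : qabs (x + y) <= qabs x + qabs y.
Proof.
rewrite -(ler_pXn2r (n := 2)) ?nnegrE ?addr_ge0 ?qabs_ge0//.
have := le_trans (ler_norm _) (ler_qre (qconj x * y)).
rewrite qabsM qabs_conj sqrrD !qabs_sqr /qnorm2 /= => h.
by rewrite mulr2n; nra.
Qed.

Lemma ler_qabs_sum (I : finType) (P : pred I) (F : I -> H) :
  qabs (\sum_(i | P i) F i) <= \sum_(i | P i) qabs (F i).
Proof.
elim/big_rec2: _ => [|i a x _ xa]; first by rewrite qabs0.
exact: le_trans (ler_qabsD _ _) (lerD (lexx _) xa).
Qed.

Lemma qreD x y : qre (x + y) = qre x + qre y. Proof. by []. Qed.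

Lemma qconjMx x : qconj x * x = Quat (qabs x ^+ 2) 0 0 0.
Proof. by rewrite qabs_sqr /qnorm2; apply: quat_ext => /=; ring. Qed.

Lemma qconj1 : qconj (1 : H) = 1.
Proof. by apply: quat_ext; rewrite /= ?oppr0. Qed.

Lemma qconjN x : qconj (- x) = - qconj x.
Proof. by apply: quat_ext. Qed.

Lemma ler_qabs_comp x e : 
  `|qre x| <= e -> `|qi x| <= e -> `|qj x| <= e -> `|qk x| <= e -> qabs x <= 2 * e.
Proof.
move=> a b c d; have e0 : 0 <= e by apply: le_trans a.
rewrite -(ler_pXn2r (n := 2)) ?nnegrE ?mulr_ge0 ?qabs_ge0// qabs_sqr /qnorm2.
move: a b c d; rewrite !ler_norml => /andP[? ?] /andP[? ?] /andP[? ?] /andP[? ?].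
nra.
Qed.

Lemma qabs_comp x : [/\ `|qre x| <= qabs x, `|qi x| <= qabs x, `|qj x| <=
    qabs x & `|qk x| <= qabs x].
Proof.
have h a : a ^+ 2 <= qnorm2 x -> `|a| <= qabs x.
  by move=> ?; rewrite qabsE -sqrtr_sqr ler_sqrt ?qnorm2_ge0.
have := (sqr_ge0 (qre x), sqr_ge0 (qi x), sqr_ge0 (qj x), sqr_ge0 (qk x)).
by case=> [[[? ?] ?] ?]; split; apply: h; rewrite /qnorm2; lra.
Qed.

End Modulus.

(** Links the modulus to the topology: balls are taken componentwise in the four real coordinates,
    each of which is bounded by the modulus. *)
Lemma ball_mx (R : realType) m n (A B : 'M[quat R]_(m, n)) e : 0 < e ->
  (forall i j, qabs (A i j - B i j) < e) -> ball A e B.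
Proof.
move=> e0 AB; split => // i j; have [] := qabs_comp (A i j - B i j).
move=> /le_lt_trans/(_ (AB i j)) ? /le_lt_trans/(_ (AB i j)) ?.
move=> /le_lt_trans/(_ (AB i j)) ? /le_lt_trans/(_ (AB i j)) ?.
by split; first split; first split.
Qed.

(** * Discrete subgroups *)

Lemma conj_divK (G : groupType) (a x z : G) :
  (x^-1 * z = a^-1 * ((a * x * a^-1)^-1 * (a * z * a^-1)) * a)%g.
Proof. by rewrite !invgM !invgK !mulgA !mulgVK mulVg mul1g. Qed.

Lemma sub_mulmx3 (S : pzRingType) n (A B C P Q U V : 'M[S]_n) :
  U = A *m (C *m Q) *m B -> V = A *m (C *m P) *m B ->
  U - V = - (A *m (C *m (P - Q)) *m B).
Proof. by move=> -> ->; rewrite !(mulmxBl, mulmxBr) opprB. Qed.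

(** * A submultiplicative norm on quaternionic matrices *)

Section MatrixNorm.
Variable R : realType.
Local Notation H := (quat R).

Definition mxabs m n (A : 'M[H]_(m, n)) : R := \sum_i \sum_j qabs (A i j).

Lemma mxabs_ge0 m n (A : 'M[H]_(m, n)) : 0 <= mxabs A.
Proof. by do 2 apply: sumr_ge0 => ? _; exact: qabs_ge0. Qed.

Lemma ler_qabs_mxabs m n (A : 'M[H]_(m, n)) i j : qabs (A i j) <= mxabs A.
Proof.
rewrite /mxabs (bigD1 i)//= (bigD1 j)//= -addrA lerDl addr_ge0//.
  by apply: sumr_ge0 => ? _; exact: qabs_ge0.
by do 2 apply: sumr_ge0 => ? _; exact: qabs_ge0.
Qed.

Lemma ler_mxabs m n (A : 'M[H]_(m, n)) e :
  (forall i j, qabs (A i j) <= e) -> mxabs A <= (m * n)%:R * e.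
Proof.
move=> Ae; have -> : (m * n)%:R * e = \sum_(i < m) \sum_(j < n) e.
  by rewrite !sumr_const !card_ord -mulrnA mulr_natl mulnC.
by apply: ler_sum => i _; apply: ler_sum => j _.
Qed.

Lemma mxabsM m n p (A : 'M[H]_(m, n)) (B : 'M[H]_(n, p)) :
  mxabs (A *m B) <= mxabs A * mxabs B.
Proof.
have -> : mxabs A * mxabs B =
    \sum_i \sum_k qabs (A i k) * \sum_l \sum_j qabs (B l j).
  by rewrite /mxabs mulr_suml; apply: eq_bigr => i _; rewrite mulr_suml.
apply: ler_sum => i _.
apply: le_trans (_ : \sum_k \sum_j qabs (A i k) * qabs (B k j) <= _).
  rewrite exchange_big; apply: ler_sum => j _; rewrite mxE.
  apply: le_trans (ler_qabs_sum _ _) _.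
  by apply: ler_sum => k _; rewrite qabsM.
apply: ler_sum => k _; rewrite -mulr_sumr ler_wpM2l ?qabs_ge0//.
rewrite [leRHS](bigD1 k)//= lerDl.
by do 2 apply: sumr_ge0 => ? _; exact: qabs_ge0.
Qed.

Lemma mxabs_adj m n (A : 'M[H]_(m, n)) : mxabs (adjmx A) = mxabs A.
Proof.
rewrite /mxabs exchange_big; apply: eq_bigr => i _; apply: eq_bigr => j _.
by rewrite !mxE qabs_conj.
Qed.

End MatrixNorm.

(** * A finite grid on bounded sets of matrices *)

Section Cells.
Variable R : realType.
Local Notation H := (quat R).

(** The intervals have length [e] and start at [- B]. [inord] sends an index beyond [N] to 0; the
    condition [2 * B / e < N%:R] in [cell_eq] rules this out on [[- B, B]]. *)
Definition cell (e B t : R) (N : nat) : 'I_N.+1 := inord (Num.truncn ((t + B) / e)).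

Lemma cell_eq e B N s t : 0 < e -> `|s| <= B -> `|t| <= B -> 2 * B / e < N%:R ->
  cell e B s N = cell e B t N -> `|s - t| <= e.
Proof.
move=> e0 sB tB BN.
have key u : `|u| <= B -> exists n : nat, [/\ (n < N.+1)%N, n = Num.truncn ((u + B) / e),
    n%:R * e <= u + B & u + B < n.+1%:R * e].
  rewrite ler_norml => /andP[uB1 uB2]; exists (Num.truncn ((u + B) / e)).
  have u0 : 0 <= (u + B) / e by rewrite divr_ge0 ?(ltW e0)// -lerBlDr sub0r.
  have /andP[h1 h2] := truncn_itv u0.
  split=> //; last 2 first.
  - by rewrite -ler_pdivlMr.
  - by rewrite -ltr_pdivrMr.
  rewrite ltnS -(ler_nat R); apply: le_trans h1 _; apply: le_trans (ltW BN).
  rewrite ler_pM2r ?invr_gt0//; apply: le_trans (_ : B + B <= _); first by rewrite lerD2r.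
  by rewrite mulrDl mul1r.
have [n [nN nE n1 n2]] := key _ sB; have [m [mN mE m1 m2]] := key _ tB.
rewrite /cell -nE -mE => /(congr1 val); rewrite /= !inordK// => nm.
move: n2 m2; rewrite -nm in m1 *; rewrite -[n.+1]addn1 natrD mulrDl mul1r => n2 m2.
by rewrite ler_norml; apply/andP; split; lra.
Qed.

Definition mxcell e B N m n (U : 'M[H]_(m, n)) :
    'M['I_N.+1 * 'I_N.+1 * 'I_N.+1 * 'I_N.+1]_(m, n) :=
  \matrix_(i, j) (cell e B (qre (U i j)) N, cell e B (qi (U i j)) N,
                  cell e B (qj (U i j)) N, cell e B (qk (U i j)) N).

Lemma mxcell_eq e B N m n (U V : 'M[H]_(m, n)) :
  0 < e -> mxabs U <= B -> mxabs V <= B -> 2 * B / e < N%:R ->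
  mxcell e B N U = mxcell e B N V -> mxabs (U - V) <= (m * n)%:R * (2 * e).
Proof.
move=> e0 UB VB BN /matrixP UV; apply: ler_mxabs => i j.
have := UV i j; rewrite !mxE => -[c1 c2 c3 c4].
have [x1 x2 x3 x4] := qabs_comp (U i j); have [y1 y2 y3 y4] := qabs_comp (V i j).
have xb := le_trans (ler_qabs_mxabs U i j) UB.
have yb := le_trans (ler_qabs_mxabs V i j) VB.
apply: ler_qabs_comp.
- exact: cell_eq e0 (le_trans x1 xb) (le_trans y1 yb) BN c1.
- exact: cell_eq e0 (le_trans x2 xb) (le_trans y2 yb) BN c2.
- exact: cell_eq e0 (le_trans x3 xb) (le_trans y3 yb) BN c3.
- exact: cell_eq e0 (le_trans x4 xb) (le_trans y4 yb) BN c4.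
Qed.

End Cells.

(** * Uniform separation in discrete groups *)

Section Discrete.
Variables (R : realType) (p : nat).
Local Notation H := (quat R).
Local Notation Sp := (Sp R p).
Local Notation J := (formmx R p).
Implicit Types (x y a : Sp) (G : set Sp).

Lemma sp_valM x y : sp_val (x * y)%g = sp_val x *m sp_val y.
Proof. by []. Qed.

Lemma sp_valV x : sp_val (x^-1)%g = J *m adjmx x *m J.
Proof. by []. Qed.

Lemma sp_val1 : sp_val (1%g : Sp) = 1%:M.
Proof. by []. Qed.

Lemma sp_val_inj : injective (@sp_val R p).
Proof. exact: val_inj. Qed.

(** Only the isolation of the identity is extracted; left translation carries the gap to the other
    elements in [discrete_separated]. *)
Lemma discrete_gap G : G 1%g -> discrete G ->
  exists2 e : R, 0 < e & forall x, G x -> mxabs (sp_val x - 1%:M) < e -> x = 1%g.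
Proof.
move=> G1 /(_ 1%:M); case; first by exists 1%g.
move=> _ [V /nbhs_ballP[e /= e0 eV] VG]; exists e => // x Gx xe.
have : (V `&` (@sp_val R p @` G)) (sp_val x).
  split; last by exists x.
  apply/eV/ball_mx => // i j; apply: le_lt_trans xe.
  have -> : 1%:M i j - sp_val x i j = - (sp_val x - 1%:M) i j.
    by rewrite !mxE opprB.
  by rewrite qabsN ler_qabs_mxabs.
by rewrite VG => /= xE; apply: sp_val_inj.
Qed.

Lemma mxabsV x : mxabs (sp_val x^-1%g) <= mxabs J ^+ 2 * mxabs (sp_val x).
Proof.
rewrite sp_valV expr2 mulrAC.
apply: le_trans (mxabsM _ _) _; rewrite ler_wpM2r ?mxabs_ge0//.
by apply: le_trans (mxabsM _ _) _; rewrite mxabs_adj.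
Qed.

(** If [a x a^-1] is bounded, so is its inverse [J x^* J] in those coordinates; hence closeness of
    the two conjugates makes [x^-1 y] close to 1, and the gap at the identity applies. *)
Lemma discrete_separated G a (B : R) : group_closed [in G] -> discrete G ->
  exists2 e : R, 0 < e & forall x y, G x -> G y ->
    mxabs (sp_val (a * x * a^-1)%g) <= B ->
    mxabs (sp_val (a * x * a^-1)%g - sp_val (a * y * a^-1)%g) < e -> x = y.
Proof.
move=> [G1 GV] /(discrete_gap (set_mem G1))[e e0 He].
(* [C] bounds the norms of all factors around the difference in the factorization of [x^-1 y - 1]
   below; the summand 1 keeps it positive. *)
pose C := mxabs (sp_val a^-1%g) * (mxabs J ^+ 2 * `|B|) * mxabs (sp_val a) + 1.
have C0 : 0 < C.
  by rewrite ltr_wpDl// !mulr_ge0 ?mxabs_ge0 ?exprn_ge0 ?mxabs_ge0.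
exists (e / C); first exact: divr_gt0.
move=> x y Gx Gy xB xy; apply: (mulgI x^-1%g); rewrite mulVg; apply/esym/He.
  apply/set_mem/(group_closedM (conj G1 GV)); last exact/mem_set.
  exact/(group_closedV (conj G1 GV))/mem_set.
have -> : sp_val (x^-1 * y)%g - 1%:M = - (sp_val a^-1%g *m
    (sp_val (a * x * a^-1)^-1%g *m
      (sp_val (a * x * a^-1)%g - sp_val (a * y * a^-1)%g)) *m sp_val a).
  have E z : sp_val (x^-1 * z)%g = sp_val a^-1%g *m
      (sp_val (a * x * a^-1)^-1%g *m sp_val (a * z * a^-1)%g) *m sp_val a.
    rewrite -!sp_valM; congr sp_val.
    exact: conj_divK.
  have Ex := E x; rewrite mulVg in Ex.
  exact: sub_mulmx3 (E y) Ex.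
have -> (A : 'M[H]_p.+2) : mxabs (- A) = mxabs A.
  by apply: eq_bigr => i _; apply: eq_bigr => j _; rewrite mxE qabsN.
apply: le_lt_trans (mxabsM _ _) _.
apply: le_lt_trans (ler_wpM2r (mxabs_ge0 _) (mxabsM _ _)) _.
set E := mxabs (_ - _) in xy *.
apply: (@le_lt_trans _ _ (mxabs (sp_val a^-1%g) * ((mxabs J ^+ 2 * `|B|) * E) * mxabs
    (sp_val a))).
  rewrite ler_wpM2r ?mxabs_ge0// ler_wpM2l ?mxabs_ge0//.
  apply: le_trans (mxabsM _ _) _; rewrite ler_wpM2r ?mxabs_ge0//.
  apply: le_trans (mxabsV _) _; rewrite ler_wpM2l ?exprn_ge0 ?mxabs_ge0//.
  exact: le_trans xB (ler_norm _).
move: xy; rewrite ltr_pdivlMr// => /(le_lt_trans _); apply.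
rewrite /C mulrDr mulr1 -[leLHS]addr0 lerD ?mxabs_ge0//.
by rewrite le_eqVlt; apply/orP; left; apply/eqP; ring.
Qed.

(* Only finitely many elements of a discrete group have norm at most [B]: by
   [discrete_separated] they lie in distinct cells of a fine enough grid. *)
Lemma discrete_no_small G a (B : R) (s : Sp -> R) :
  group_closed [in G] -> discrete G ->
  exists2 e : R, 0 < e & forall x, G x ->
    mxabs (sp_val (a * x * a^-1)%g) <= B -> s x < e -> s x <= 0.
Proof.
move=> Gg Gd; have [e e0 He] := discrete_separated a B Gg Gd.
(* Two matrices in the same cell of mesh [d] differ by at most [(p.+2 * p.+2)%:R * (2 * d)], which
   is less than [e] for [d = e / K]. *)
pose K : R := ((p.+2 * p.+2)%:R * 2) + 1.
have K0 : 0 < K by rewrite ltr_wpDl// mulr_ge0.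
pose d := e / K; have d0 : 0 < d by rewrite divr_gt0.
pose N := (Num.truncn (2 * B / d)).+1.
have NB : 2 * B / d < N%:R by rewrite truncnS_gt.
pose code x := mxcell d B N (sp_val (a * x * a^-1)%g).
have code_inj x y : G x -> G y -> mxabs (sp_val (a * x * a^-1)%g) <= B ->
    mxabs (sp_val (a * y * a^-1)%g) <= B -> code x = code y -> x = y.
  move=> Gx Gy xB yB xy; apply: He => //.
  apply: le_lt_trans (mxcell_eq d0 xB yB NB xy) _.
  by rewrite mulrA /d mulrCA gtr_pMr// ltr_pdivrMr// mul1r /K ltrDl.
(* Each code belongs to at most one bounded element of [G], so a threshold exists code by code; the
   codes form a finite type, so one threshold serves all of them. *)
have : \forall d \near (0 : R)^'+, forall t, forall x, G x -> code x = t ->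
    mxabs (sp_val (a * x * a^-1)%g) <= B -> s x < d -> s x <= 0.
  apply: filter_forall => t.
  have [[x [Gx xt xB sx]]|no] := pselect (exists x, [/\ G x, code x = t,
      mxabs (sp_val (a * x * a^-1)%g) <= B & 0 < s x]).
    near=> r => y Gy yt yB; rewrite -(code_inj x y) ?xt ?yt// => xr.
    suff : r <= s x by rewrite leNgt xr.
    by near: r; exact: nbhs_right_le.
  near=> r => y Gy yt yB _; rewrite leNgt; apply/negP => sy.
  by apply: no; exists y.
move=> /(filterI (nbhs_right_gt 0)) /filter_ex[r [r0 Hr]].
by exists r => // x Gx xB; apply: (Hr (code x)).
Unshelve. all: by end_near.
Qed.

End Discrete.

(** * Corner entries *)

(** Cauchy-Schwarz, from the nonnegative sum of the squares of [f i * G - g i * S], which equals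
    [G * (F * G - S ^+ 2)]. *)
Lemma sum_mul_sqr_le (R : realFieldType) (I : finType) (P : pred I) (f g : I -> R) :
  (\sum_(i | P i) f i * g i) ^+ 2 <=
  (\sum_(i | P i) f i ^+ 2) * (\sum_(i | P i) g i ^+ 2).
Proof.
set S := \sum_(i | P i) f i * g i; set F := \sum_(i | P i) f i ^+ 2.
set G := \sum_(i | P i) g i ^+ 2.
have G0 : 0 <= G by apply: sumr_ge0 => i _; exact: sqr_ge0.
have [G00|Gn0] := eqVneq G 0.
  have g0 i : P i -> g i = 0.
    move=> Pi; apply/eqP; rewrite -sqrf_eq0; apply/eqP.
    by move: (Pi) => /(psumr_eq0P (fun i _ => sqr_ge0 (g i)) G00).
  by rewrite G00 mulr0 /S big1 ?expr0n// => i Pi; rewrite g0 ?mulr0.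
have : 0 <= \sum_(i | P i) (f i * G - g i * S) ^+ 2.
  by apply: sumr_ge0 => i _; exact: sqr_ge0.
have -> : \sum_(i | P i) (f i * G - g i * S) ^+ 2 = G * (F * G - S ^+ 2).
  transitivity (F * G ^+ 2 - S * (2 * G * S) + G * S ^+ 2); last by ring.
  rewrite /F /S /G !mulr_suml -sumrB -big_split; apply: eq_bigr => i _ /=.
  by rewrite -/G -/S; ring.
by rewrite pmulr_rge0 ?subr_ge0// lt_neqAle eq_sym Gn0.
Qed.

Section Entries.
Variables (R : realType) (p : nat).
Local Notation H := (quat R).
Local Notation Sp := (Sp R p).
Local Notation J := (formmx R p).
Local Notation N := (pen_ord p).
Local Notation X := (ord_max : 'I_p.+2).
Implicit Types (x y : Sp) (l : 'rV[H]_p.+2).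

Lemma val_pen : val N = p.
Proof. by rewrite /= inordK. Qed.

Lemma pen_lt : (N < p)%N = false.
Proof. by rewrite val_pen ltnn. Qed.

Lemma max_lt : (X < p)%N = false.
Proof. by rewrite ltnNge leqnSn. Qed.

Lemma pen_neq_max : N != X.
Proof. by rewrite -val_eqE val_pen /= ltn_eqF. Qed.

Lemma ord_cases (i : 'I_p.+2) : [\/ (i < p)%N, i = N | i = X].
Proof.
have [ip|pi] := ltnP i p; first by constructor 1.
have [iN|iN] := eqVneq i N; first by constructor 2.
constructor 3; apply/val_inj/eqP; rewrite /= eqn_leq -ltnS ltn_ord /=.
by rewrite ltn_neqAle pi andbT; move: iN; rewrite eq_sym -val_eqE val_pen.
Qed.

Lemma sum_pen_max (V : nmodType) (F : 'I_p.+2 -> V) :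
  \sum_i F i = \sum_(i < p.+2 | (i < p)%N) F i + F N + F X.
Proof.
rewrite (bigID (fun i : 'I_p.+2 => (i < p)%N)) /= -addrA; congr (_ + _).
rewrite (bigD1 N) ?pen_lt//= (bigD1 X)/=; last by rewrite max_lt eq_sym pen_neq_max.
rewrite big1 ?addr0// => i /andP[/andP[ip iN] iX].
by case: (ord_cases i) => [|E|E]; rewrite ?(negPf ip)//; move: iN iX; rewrite E ?eqxx.
Qed.

Lemma formmx_pen i : J N i = if i == X then -1 else 0.
Proof. by rewrite mxE pen_lt eqxx /= (negPf pen_neq_max) orbF. Qed.

Lemma formmx_max i : J X i = if i == N then -1 else 0.
Proof. by rewrite mxE max_lt /= eqxx eq_sym (negPf pen_neq_max). Qed.

Lemma formmx_low (i j : 'I_p.+2) : (i < p)%N -> J i j = if i == j then 1 else 0.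
Proof.
move=> ip; rewrite mxE ip /=; case: eqP => // _.
case: (i =P N) ip => [->|_]; rewrite ?pen_lt//.
by case: (i =P X) => [->|_]; rewrite ?max_lt.
Qed.

Lemma mulJmx_pen n (B : 'M[H]_(p.+2, n)) j : (J *m B) N j = - B X j.
Proof.
rewrite mxE (bigD1 X)//= big1 => [|i iX]; rewrite formmx_pen ?eqxx ?(negPf iX) ?mul0r//.
by rewrite mulN1r addr0.
Qed.

Lemma mulJmx_max n (B : 'M[H]_(p.+2, n)) j : (J *m B) X j = - B N j.
Proof.
rewrite mxE (bigD1 N)//= big1 => [|i iX]; rewrite formmx_max ?eqxx ?(negPf iX) ?mul0r//.
by rewrite mulN1r addr0.
Qed.

Lemma mulJmx_low n (B : 'M[H]_(p.+2, n)) (i : 'I_p.+2) j : (i < p)%N -> (J *m B) i j = B i j.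
Proof.
move=> ip; rewrite mxE (bigD1 i)//= big1 => [|k ki]; rewrite formmx_low ?eqxx//.
  by rewrite mul1r addr0.
by rewrite eq_sym (negPf ki) mul0r.
Qed.

Lemma adjJ_mx m (A : 'M[H]_(m, p.+2)) : A *m J = adjmx (J *m adjmx A).
Proof. by rewrite adjmxM adjmxK adj_formmx. Qed.

Lemma mulmxJ_pen m (A : 'M[H]_(m, p.+2)) i : (A *m J) i N = - A i X.
Proof. by rewrite adjJ_mx 2!mxE mulJmx_pen !mxE qconjN qconjK. Qed.

Lemma mulmxJ_max m (A : 'M[H]_(m, p.+2)) i : (A *m J) i X = - A i N.
Proof. by rewrite adjJ_mx 2!mxE mulJmx_max !mxE qconjN qconjK. Qed.

Lemma mulmxJmxE m n (A : 'M[H]_(m, p.+2)) (B : 'M[H]_(p.+2, n)) i j :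
  (A *m J *m B) i j =
  \sum_(k < p.+2 | (k < p)%N) A i k * B k j - A i N * B X j - A i X * B N j.
Proof.
rewrite -mulmxA mxE sum_pen_max mulJmx_pen mulJmx_max !mulrN; congr (_ - _ - _).
by apply: eq_bigr => k kp; rewrite mulJmx_low.
Qed.

Lemma Sp_inv_pen_pen y : sp_val (y^-1)%g N N = qconj (y X X).
Proof. by rewrite sp_valV mulmxJ_pen mulJmx_pen !mxE opprK. Qed.

Lemma Sp_inv_pen_max y : sp_val (y^-1)%g N X = qconj (y N X).
Proof. by rewrite sp_valV mulmxJ_max mulJmx_pen !mxE opprK. Qed.

Lemma Sp_inv_max_pen y : sp_val (y^-1)%g X N = qconj (y X N).
Proof. by rewrite sp_valV mulmxJ_pen mulJmx_max !mxE opprK. Qed.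

Lemma Sp_inv_max_max y : sp_val (y^-1)%g X X = qconj (y N N).
Proof. by rewrite sp_valV mulmxJ_max mulJmx_max !mxE opprK. Qed.

Lemma Sp_col y i j :
  \sum_(k < p.+2 | (k < p)%N) qconj (y k i) * y k j
    - qconj (y N i) * y X j - qconj (y X i) * y N j = J i j.
Proof.
rewrite -[in RHS](eqP (spP y)) mulmxJmxE; congr (_ - _ - _); last 2 first.
- by rewrite !mxE.
- by rewrite !mxE.
by apply: eq_bigr => k _; rewrite !mxE.
Qed.

Lemma mul_diag_mxE n (A : 'M[H]_n) (m : 'rV[H]_n) i j :
  (diag_mx m *m A) i j = m 0 i * A i j.
Proof. by rewrite mul_diag_mx mxE. Qed.

Lemma mul_mx_diagE n (A : 'M[H]_n) (m : 'rV[H]_n) i j :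
  (A *m diag_mx m) i j = A i j * m 0 j.
Proof. by rewrite mul_mx_diag mxE. Qed.

(** The Hermitian form of rows [i] and [j] of [y], weighted by [l]. Since [y^-1 = J y^* J] and the
    last [J] only exchanges the last two columns up to sign, these values are, up to sign, the
    entries of [y D y^-1] in those columns. *)
Definition rowform (y : 'M[H]_p.+2) l i j : H :=
  \sum_(k < p.+2 | (k < p)%N) y i k * l 0 k * qconj (y j k)
    - y i N * l 0 N * qconj (y j X) - y i X * l 0 X * qconj (y j N).

Lemma rowformE y l i j : rowform y l i j = (sp_val y *m diag_mx l *m J *m adjmx y) i j.
Proof.
have dE k : (sp_val y *m diag_mx l) i k = y i k * l 0 k by exact: mul_mx_diagE.
rewrite mulmxJmxE !dE; congr (_ - _ - _); last 2 first.
- by rewrite !mxE.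
- by rewrite !mxE.
by apply: eq_bigr => k _; rewrite dE !mxE.
Qed.

Lemma conj_diag_pen D y l i : sp_val D = diag_mx l ->
  sp_val (y * D * y^-1)%g i N = - rowform y l i X.
Proof. by move=> Dl; rewrite sp_valM sp_valV mulmxA mulmxJ_pen rowformE !mulmxA sp_valM Dl. Qed.

Lemma conj_diag_max D y l i : sp_val D = diag_mx l ->
  sp_val (y * D * y^-1)%g i X = - rowform y l i N.
Proof. by move=> Dl; rewrite sp_valM sp_valV mulmxA mulmxJ_max rowformE !mulmxA sp_valM Dl. Qed.

Lemma rowform1 y i j : rowform y (const_mx 1) i j = J i j.
Proof.
rewrite rowformE diag_const_mx mulmx1.
have : sp_val (y * y^-1)%g = 1%:M by rewrite mulgV.
rewrite sp_valM sp_valV !mulmxA => /(congr1 (mulmx^~ J)).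
by rewrite -!mulmxA formmxK mulmx1 mul1mx => ->.
Qed.

Lemma Sp_row y i j :
  \sum_(k < p.+2 | (k < p)%N) y i k * qconj (y j k)
    - y i N * qconj (y j X) - y i X * qconj (y j N) = J i j.
Proof.
rewrite -(rowform1 y) /rowform !mxE !mulr1; congr (_ - _ - _).
by apply: eq_bigr => k _; rewrite mxE mulr1.
Qed.

Lemma qre_sum (I : finType) (P : pred I) (F : I -> H) :
  qre (\sum_(i | P i) F i) = \sum_(i | P i) qre (F i).
Proof. exact: (big_morph (@qre R) (@qreD R)). Qed.

(** A row with [J i i = 0] is null, so the squared length of its first entries is twice the real
    part of the product of one of its last two entries with the conjugate of the other. *)
Lemma row_norm y i : J i i = 0 ->
  \sum_(k < p.+2 | (k < p)%N) qabs (y i k) ^+ 2 <= 2 * (qabs (y i N) * qabs (y i X)).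
Proof.
move=> Jii; have := congr1 (@qre R) (Sp_row y i i); rewrite Jii !qreD qre_sum.
have -> : \sum_(k < p.+2 | (k < p)%N) qre (y i k * qconj (y i k)) =
    \sum_(k < p.+2 | (k < p)%N) qabs (y i k) ^+ 2.
  by apply: eq_bigr => k _; rewrite -[y i k in X in X * _]qconjK qconjMx qabs_conj.
have := le_trans (ler_norm _) (ler_qre (y i N * qconj (y i X))).
have := le_trans (ler_norm _) (ler_qre (y i X * qconj (y i N))).
rewrite !qabsM !qabs_conj.
move: (y i N * _) (y i X * _) => s t /=; lra.
Qed.

Lemma col_norm y j :
  \sum_(k < p.+2 | (k < p)%N) qabs (y k j) ^+ 2 <=
  qre (J j j) + 2 * (qabs (y N j) * qabs (y X j)).
Proof.
have := congr1 (@qre R) (Sp_col y j j); rewrite !qreD qre_sum.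
have -> : \sum_(k < p.+2 | (k < p)%N) qre (qconj (y k j) * y k j) =
    \sum_(k < p.+2 | (k < p)%N) qabs (y k j) ^+ 2.
  by apply: eq_bigr => k _; rewrite qconjMx.
have := le_trans (ler_norm _) (ler_qre (qconj (y N j) * y X j)).
have := le_trans (ler_norm _) (ler_qre (qconj (y X j) * y N j)).
rewrite !qabsM !qabs_conj.
move: (_ * y X j) (_ * y N j) => s t /=; lra.
Qed.

Lemma formmx_pen_pen : J N N = 0.
Proof. by rewrite formmx_pen (negPf pen_neq_max). Qed.

Lemma formmx_max_max : J X X = 0.
Proof. by rewrite formmx_max eq_sym (negPf pen_neq_max). Qed.

End Entries.

(** * Triangle inequality for the Cygan metric *)

Section NullRows.
Variables (R : realType) (I : finType) (P : pred I).
Local Notation H := (quat R).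
Implicit Types f g : I -> H.

Lemma ler_sum_qabsM f g (U V : R) :
  \sum_(i | P i) qabs (f i) ^+ 2 <= 2 * U ->
  \sum_(i | P i) qabs (g i) ^+ 2 <= 2 * V ->
  \sum_(i | P i) qabs (f i) * qabs (g i) <= 2 * Num.sqrt (U * V).
Proof.
move=> fU gV; have f0 : 0 <= \sum_(i | P i) qabs (f i) ^+ 2.
  by apply: sumr_ge0 => i _; exact: sqr_ge0.
have g0 : 0 <= \sum_(i | P i) qabs (g i) ^+ 2.
  by apply: sumr_ge0 => i _; exact: sqr_ge0.
have U0 : 0 <= U by rewrite -(pmulr_rge0 _ (ltr0n _ 2)); exact: le_trans fU.
have V0 : 0 <= V by rewrite -(pmulr_rge0 _ (ltr0n _ 2)); exact: le_trans gV.
rewrite -(ler_pXn2r (n := 2)) ?nnegrE ?mulr_ge0 ?sqrtr_ge0//; last first.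
  by apply: sumr_ge0 => i _; rewrite mulr_ge0 ?qabs_ge0.
rewrite exprMn sqr_sqrtr ?mulr_ge0//.
apply: le_trans (sum_mul_sqr_le _ _ _) _.
by apply: le_trans (ler_pM f0 g0 fU gV) _; rewrite expr2 mulrACA.
Qed.

Lemma sum_qabs_sqr f (x : H) : \sum_(i | P i) f i * qconj (f i) = x + qconj x ->
  \sum_(i | P i) qabs (f i) ^+ 2 <= 2 * qabs x.
Proof.
move=> /(congr1 (@qre R)); rewrite qre_sum.
have -> : \sum_(i | P i) qre (f i * qconj (f i)) = \sum_(i | P i) qabs (f i) ^+ 2.
  by apply: eq_bigr => i _; rewrite -[f i in X in X * _]qconjK qconjMx qabs_conj.
move=> -> /=; have := le_trans (ler_norm _) (ler_qre x); lra.
Qed.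

Lemma qconj_sumP f : qconj (\sum_(i | P i) f i) = \sum_(i | P i) qconj (f i).
Proof.
apply: (big_morph _ (@qconjD R)).
by apply: quat_ext; rewrite /= ?oppr0.
Qed.

(* The triangle inequality for the Cygan metric: [E] is the form evaluated on
   the null vectors [(f, A, 1)] and [(g, C, 1)] up to sign. *)
Lemma cygan_triangle f g (A C : H) :
  let E := A + qconj C - \sum_(i | P i) f i * qconj (g i) in
  \sum_(i | P i) f i * qconj (f i) = A + qconj A ->
  \sum_(i | P i) g i * qconj (g i) = C + qconj C ->
  Num.sqrt (qabs A) <= Num.sqrt (qabs E) + Num.sqrt (qabs C).
Proof.
move=> E fA gC.
have fg : \sum_(i | P i) f i * qconj (g i) = A + qconj C - E.
  by rewrite /E opprB addrC subrK.
have gf : \sum_(i | P i) g i * qconj (f i) = qconj A + C - qconj E.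
  transitivity (qconj (A + qconj C - E)); last by apply: quat_ext => /=; ring.
  by rewrite -fg qconj_sumP; apply: eq_bigr => i _; rewrite qconjM qconjK.
have hE : \sum_(i | P i) (f i - g i) * qconj (f i - g i) = E + qconj E.
  transitivity (\sum_(i | P i) f i * qconj (f i) - \sum_(i | P i) f i * qconj (g i)
      - \sum_(i | P i) g i * qconj (f i) + \sum_(i | P i) g i * qconj (g i)).
    rewrite -!sumrB -big_split; apply: eq_bigr => i _ /=.
    by apply: quat_ext => /=; ring.
  by rewrite fg gf fA gC; apply: quat_ext => /=; ring.
have hg : \sum_(i | P i) (f i - g i) * qconj (g i) = A - E - C.
  transitivity (\sum_(i | P i) f i * qconj (g i) - \sum_(i | P i) g i * qconj (g i)).
    by rewrite -sumrB; apply: eq_bigr => i _; rewrite mulrBl.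
  by rewrite fg gC; apply: quat_ext => /=; ring.
have cs := ler_sum_qabsM (sum_qabs_sqr hE) (sum_qabs_sqr gC).
(* [A - E - C] is the product of [f - g] with [g], whose squared lengths are at most [2 * qabs E]
   and [2 * qabs C]. With Cauchy-Schwarz the right-hand side becomes the square of the sum of the
   two roots. *)
have hA : qabs A <= qabs E + qabs C + 2 * Num.sqrt (qabs E * qabs C).
  have -> : A = E + C + (A - E - C) by apply: quat_ext => /=; ring.
  apply: le_trans (ler_qabsD _ _) _; rewrite lerD ?ler_qabsD// -hg.
  apply: le_trans (ler_qabs_sum _ _) (le_trans _ cs).
  by apply: ler_sum => i _; rewrite qabsM qabs_conj.
rewrite -(ler_pXn2r (n := 2)) ?nnegrE ?addr_ge0 ?sqrtr_ge0//.
rewrite sqrrD !sqr_sqrtr ?qabs_ge0//; move: hA.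
by rewrite sqrtrM ?qabs_ge0// mulr_natl addrAC.
Qed.

(** Ptolemy's inequality for four boundary points: the null rows [(f, a, b)] and [(g, c, d)], whose
    product is [-1], and the two ends of the axis. Dividing the rows on the left by [b] and [d]
    makes their last coordinates 1 and reduces it to [cygan_triangle]. *)
Lemma ptolemy f g (a b c d : H) :
  \sum_(i | P i) f i * qconj (f i) - a * qconj b - b * qconj a = 0 ->
  \sum_(i | P i) g i * qconj (g i) - c * qconj d - d * qconj c = 0 ->
  \sum_(i | P i) f i * qconj (g i) - a * qconj d - b * qconj c = -1 ->
  Num.sqrt (qabs a * qabs d) <= 1 + Num.sqrt (qabs b * qabs c).
Proof.
move=> ff gg fg.
have [->|d0] := eqVneq d 0; first by rewrite qabs0 mulr0 sqrtr0 addr_ge0 ?sqrtr_ge0.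
(* Here the first row represents the point at infinity and cannot be normalized; nullity forces
   [f = 0], hence |ad| = 1. *)
have [b0|b0] := eqVneq b 0.
  have f0 : \sum_(i | P i) qabs (f i) ^+ 2 <= 2 * qabs (0 : H).
    apply: sum_qabs_sqr; move: ff; rewrite b0.
    rewrite (_ : qconj 0 = 0) ?mulr0 ?mul0r ?subr0 ?addr0//.
    by apply: quat_ext; rewrite /= ?oppr0.
  have g0 : \sum_(i | P i) qabs (g i) ^+ 2 <= 2 * qabs (c * qconj d).
    by apply: sum_qabs_sqr; rewrite qconjM qconjK; apply/eqP; rewrite -subr_eq0 opprD addrA gg.
  have := ler_sum_qabsM f0 g0; rewrite qabs0 mul0r sqrtr0 mulr0 => fg0.
  have : qabs (a * qconj d) = 1.
    rewrite -[RHS](qabs1 R) -[in RHS]qabsN -fg b0 mul0r subr0.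
    rewrite (_ : \sum_(i | P i) _ = 0) ?sub0r ?qabsN//.
    apply/eqP; rewrite -qabs_eq0 eq_le qabs_ge0 andbT.
    apply: le_trans (ler_qabs_sum _ _) (le_trans _ fg0).
    by apply: ler_sum => i _; rewrite qabsM qabs_conj.
  by rewrite qabsM qabs_conj => ->; rewrite sqrtr1 lerDl sqrtr_ge0.
have ub : b \is a GRing.unit by [].
have ud : d \is a GRing.unit by [].
have cV (x : H) : x != 0 -> qconj x^-1 = (qconj x)^-1.
  move=> x0; have cx0 : qconj x != 0 by rewrite -qabs_eq0 qabs_conj qabs_eq0.
  have ux : qconj x \is a GRing.unit by [].
  apply: (mulIr ux); rewrite mulVr// -qconjM divrr ?qconj1//.
have nd : qconj d != 0 by rewrite -qabs_eq0 qabs_conj qabs_eq0.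
have nb : qconj b != 0 by rewrite -qabs_eq0 qabs_conj qabs_eq0.
have := @cygan_triangle (fun i => b^-1 * f i) (fun i => d^-1 * g i) (b^-1 * a) (d^-1 * c).
have scale (x y : H) (u v : I -> H) : \sum_(i | P i) (x * u i) * qconj (y * v i) =
    x * (\sum_(i | P i) u i * qconj (v i)) * qconj y.
  rewrite mulr_sumr mulr_suml; apply: eq_bigr => i _.
  by rewrite qconjM !mulrA.
rewrite /= !scale.
move/eqP: ff; rewrite -addrA -opprD subr_eq0 => /eqP ->.
move/eqP: gg; rewrite -addrA -opprD subr_eq0 => /eqP ->.
move/eqP: fg; rewrite -addrA -opprD subr_eq => /eqP ->.
rewrite !qconjM !cV// !(mulrDr, mulrDl).
have bb x : b^-1 * (b * x) = x by rewrite mulrA mulVr// mul1r.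
have dd x : d^-1 * (d * x) = x by rewrite mulrA mulVr// mul1r.
rewrite -!mulrA !bb !dd !divrr ?mulr1//.
move=> /(_ (erefl _) (erefl _)).
(* The normalized product of the two rows is the original [-1] divided by [b] and [qconj d];
   multiplying the triangle inequality by the root of |bd| then turns this term into 1. *)
set E := _ - _; have -> : E = b^-1 / qconj d.
  by rewrite /E mulN1r mulrN; move: (b^-1 * a) (qconj c / _) (b^-1 / _) => x y z;
      apply: quat_ext => /=; ring.
rewrite !qabsM !qabsV qabs_conj.
have a0 := qabs_ge0 a; have c0 := qabs_ge0 c.
have pb : 0 < qabs b by rewrite lt_neqAle eq_sym qabs_eq0 b0 qabs_ge0.
have pd : 0 < qabs d by rewrite lt_neqAle eq_sym qabs_eq0 d0 qabs_ge0.
move: (qabs a) (qabs b) (qabs c) (qabs d) a0 pb c0 pd => s t u w s0 t0 u0 w0 h.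
have {h} := ler_wpM2r (sqrtr_ge0 (t * w)) h.
rewrite mulrDl -!sqrtrM ?mulr_ge0 ?invr_ge0 ?(ltW t0) ?(ltW w0)//.
have -> : t^-1 * s * (t * w) = s * w by field; rewrite gt_eqF.
have -> : t^-1 / w * (t * w) = 1 by field; rewrite !gt_eqF.
have -> : w^-1 * u * (t * w) = t * u by field; rewrite gt_eqF.
by rewrite sqrtr1.
Qed.

End NullRows.

(** * Growth of the corner entries in one step *)

Section Corner.
Variables (R : realType) (p : nat).
Local Notation H := (quat R).
Local Notation Sp := (Sp R p).
Local Notation N := (pen_ord p).
Local Notation X := (ord_max : 'I_p.+2).
Implicit Types (x y : Sp) (l : 'rV[H]_p.+2).

(* |bc| and |ad| are the absolute cross-ratios of the theorem. *)
Definition corner_a y : R := qabs (sp_val y N N).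
Definition corner_b y : R := qabs (sp_val y N X).
Definition corner_c y : R := qabs (sp_val y X N).
Definition corner_d y : R := qabs (sp_val y X X).
Definition rt_ad y : R := Num.sqrt (corner_a y * corner_d y).
Definition rt_bc y : R := Num.sqrt (corner_b y * corner_c y).

Lemma corner_a_ge0 y : 0 <= corner_a y. Proof. exact: qabs_ge0. Qed.
Lemma corner_b_ge0 y : 0 <= corner_b y. Proof. exact: qabs_ge0. Qed.
Lemma corner_c_ge0 y : 0 <= corner_c y. Proof. exact: qabs_ge0. Qed.
Lemma corner_d_ge0 y : 0 <= corner_d y. Proof. exact: qabs_ge0. Qed.
Lemma rt_ad_ge0 y : 0 <= rt_ad y. Proof. exact: sqrtr_ge0. Qed.
Lemma rt_bc_ge0 y : 0 <= rt_bc y. Proof. exact: sqrtr_ge0. Qed.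

Lemma rt_ad_sqr y : rt_ad y ^+ 2 = corner_a y * corner_d y.
Proof. by rewrite sqr_sqrtr// mulr_ge0 ?corner_a_ge0 ?corner_d_ge0. Qed.

Lemma rt_bc_sqr y : rt_bc y ^+ 2 = corner_b y * corner_c y.
Proof. by rewrite sqr_sqrtr// mulr_ge0 ?corner_b_ge0 ?corner_c_ge0. Qed.

Lemma Sp_row_pen_max y :
  \sum_(k < p.+2 | (k < p)%N) sp_val y N k * qconj (sp_val y X k)
    - sp_val y N N * qconj (sp_val y X X)
    - sp_val y N X * qconj (sp_val y X N) = -1.
Proof. by rewrite Sp_row formmx_pen eqxx. Qed.

Lemma rt_ad_le y : rt_ad y <= 1 + rt_bc y.
Proof.
rewrite /rt_ad /rt_bc; apply: (ptolemy (f := fun k => sp_val y N k)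
  (g := fun k => sp_val y X k) (P := fun k : 'I_p.+2 => (k < p)%N)).
- by rewrite Sp_row formmx_pen_pen.
- by rewrite Sp_row formmx_max_max.
- exact: Sp_row_pen_max.
Qed.

(** The form is symmetric in the last two coordinates, so [ptolemy] applies with the two entries of
    each row exchanged. *)
Lemma rt_bc_le y : rt_bc y <= 1 + rt_ad y.
Proof.
rewrite /rt_ad /rt_bc; apply: (ptolemy (f := fun k => sp_val y N k)
  (g := fun k => sp_val y X k) (P := fun k : 'I_p.+2 => (k < p)%N)).
- by rewrite addrAC Sp_row formmx_pen_pen.
- by rewrite addrAC Sp_row formmx_max_max.
- by rewrite addrAC; exact: Sp_row_pen_max.
Qed.

Lemma pen_norm y : \sum_(k < p.+2 | (k < p)%N) qabs (sp_val y N k) ^+ 2 <=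
    2 * (corner_a y * corner_b y).
Proof. exact/row_norm/formmx_pen_pen. Qed.

Lemma max_norm y : \sum_(k < p.+2 | (k < p)%N) qabs (sp_val y X k) ^+ 2 <=
    2 * (corner_c y * corner_d y).
Proof. exact/row_norm/formmx_max_max. Qed.

Lemma pen_max_norm y :
  \sum_(k < p.+2 | (k < p)%N) qabs (sp_val y N k) * qabs (sp_val y X k) <=
  2 * (rt_ad y * rt_bc y).
Proof.
apply: le_trans (ler_sum_qabsM (pen_norm y) (max_norm y)) _.
have s0 : 0 <= corner_a y * corner_d y by rewrite mulr_ge0 ?corner_a_ge0 ?corner_d_ge0.
rewrite /rt_ad /rt_bc -(sqrtrM _ s0).
by have -> : corner_a y * corner_b y * (corner_c y * corner_d y) =
    corner_a y * corner_d y * (corner_b y * corner_c y) by ring.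
Qed.

(** The third Ptolemy inequality; it will exclude that |ad| and |bc| vanish together. The relation
    between the two rows writes 1 as a sum bounded by |ad| + |bc| + 2 |abcd|^(1/2), the square of
    the right-hand side. *)
Lemma rt_ad_bc_ge1 y : 1 <= rt_ad y + rt_bc y.
Proof.
have sr0 : 0 <= rt_ad y + rt_bc y by exact: addr_ge0 (rt_ad_ge0 y) (rt_bc_ge0 y).
rewrite -(expr_ge1 (n := 2)) // sqrrD rt_ad_sqr rt_bc_sqr -(qabs1 R).
have e := Sp_row_pen_max y; set S := \sum_(_ < _ | _) _ in e.
have -> : (1 : H) = sp_val y N N * qconj (sp_val y X X) +
    - S + sp_val y N X * qconj (sp_val y X N).
  apply: oppr_inj; rewrite -{}e; clearbody S.
  move: (_ * _) (sp_val y N X * _) => s t.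
  by apply: quat_ext => /=; ring.
apply: le_trans (ler_qabsD _ _) (lerD _ _); last by rewrite qabsM qabs_conj.
apply: le_trans (ler_qabsD _ _) (lerD _ _); first by rewrite qabsM qabs_conj.
rewrite qabsN -mulr_natl; apply: le_trans (ler_qabs_sum _ _) (le_trans _ (pen_max_norm y)).
by apply: ler_sum => k _; rewrite qabsM qabs_conj.
Qed.

Lemma rowform_sub y l i j :
  rowform y l i j - rowform y (const_mx 1) i j = rowform y (l - const_mx 1) i j.
Proof.
have lE k : (l - const_mx 1) 0 k = l 0 k - 1 by rewrite !mxE.
rewrite /rowform !lE.
rewrite (_ : \sum_(k < p.+2 | (k < p)%N) sp_val y i k * (l - const_mx 1) 0 k * qconj
    (sp_val y j k)
  = \sum_(k < p.+2 | (k < p)%N) sp_val y i k * l 0 k * qconj (sp_val y j k) -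
    \sum_(k < p.+2 | (k < p)%N) sp_val y i k * 1 * qconj (sp_val y j k)); last first.
  by rewrite -sumrB; apply: eq_bigr => k _; rewrite lE mulrBr mulrBl.
have -> : \sum_(k < p.+2 | (k < p)%N) sp_val y i k * (const_mx 1 : 'rV[H]_p.+2) 0 k * qconj
    (sp_val y j k) =
    \sum_(k < p.+2 | (k < p)%N) sp_val y i k * 1 * qconj (sp_val y j k).
  by apply: eq_bigr => k _; congr (_ * _ * _); rewrite mxE.
have oE k : (const_mx 1 : 'rV[H]_p.+2) 0 k = 1 by rewrite mxE.
rewrite !oE !(mulrBr, mulrBl).
move: (\sum_(_ < _ | _) _) (\sum_(_ < _ | _) _) => S T.
move: (sp_val y i N * l 0 N * _) (sp_val y i N * 1 * _) => s t.
move: (sp_val y i X * l 0 X * _) (sp_val y i X * 1 * _) => u v.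
by apply: quat_ext => /=; ring.
Qed.

Lemma ler_rowform (y : 'M[H]_p.+2) l i j (e : R) :
  (forall k : 'I_p.+2, (k < p)%N -> qabs (l 0 k) <= e) ->
  qabs (rowform y l i j) <=
    e * (\sum_(k < p.+2 | (k < p)%N) qabs (y i k) * qabs (y j k))
    + qabs (l 0 N) * (qabs (y i N) * qabs (y j X))
    + qabs (l 0 X) * (qabs (y i X) * qabs (y j N)).
Proof.
move=> le; rewrite /rowform.
apply: le_trans (ler_qabsD _ _) _; rewrite lerD//; last first.
  by rewrite qabsN !qabsM qabs_conj mulrAC mulrC.
apply: le_trans (ler_qabsD _ _) _; rewrite lerD//; last first.
  by rewrite qabsN !qabsM qabs_conj mulrAC mulrC.
apply: le_trans (ler_qabs_sum _ _) _; rewrite mulr_sumr; apply: ler_sum => k kp.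
rewrite !qabsM qabs_conj mulrAC mulrC ler_wpM2r ?mulr_ge0 ?qabs_ge0//.
exact: le.
Qed.

Section Step.
Variables (D : Sp) (l : 'rV[H]_p.+2) (r d M : R).
Hypothesis Dl : sp_val D = diag_mx l.
Hypothesis l1 : forall i : 'I_p.+2, (i < p)%N -> qabs (l 0 i) = 1.
Hypothesis lN : qabs (l 0 N) = r.
Hypothesis lX : qabs (l 0 X) = r^-1.
Hypothesis ld : forall i : 'I_p.+2, (i < p)%N -> qabs (l 0 i - 1) <= d.
Hypothesis d0 : 0 <= d.
Hypothesis ME : M = 2 * d + qabs (l 0 N - 1) + qabs (l 0 X - 1).

Lemma step_M_ge0 : 0 <= M.
Proof. by rewrite ME !addr_ge0 ?qabs_ge0// mulr_ge0. Qed.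

(** The origin of [M_g]: the form with all weights 1 vanishes on the null row [i], and subtracting
    it replaces [l] by [l - 1]. By [row_norm] the first entries contribute at most [2 * d] times the
    product of the last two moduli, which explains the factor 2. *)
Lemma rowform_diag_le y i : formmx R p i i = 0 ->
  qabs (rowform y l i i) <= M * (qabs (sp_val y i N) * qabs (sp_val y i X)).
Proof.
move=> Jii; rewrite -[rowform y l i i]subr0 -Jii -(rowform1 y) rowform_sub.
have lE k : (l - const_mx 1) 0 k = l 0 k - 1 by rewrite !mxE.
apply: le_trans (@ler_rowform _ _ _ _ d _) _ => [k kp|]; first by rewrite lE ld.
have := ler_wpM2l d0 (row_norm y Jii); rewrite !lE ME.
have -> : \sum_(k < p.+2 | (k < p)%N) qabs (sp_val y i k) * qabs (sp_val y i k) =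
   \sum_(k < p.+2 | (k < p)%N) qabs (sp_val y i k) ^+ 2.
  by apply: eq_bigr => k _; rewrite expr2.
rewrite [qabs (sp_val y i X) * qabs (sp_val y i N)]mulrC.
set z := qabs (sp_val y i N) * _; set u := qabs (_ - 1); set v := qabs (_ - 1) => h.
have -> : (2 * d + u + v) * z = d * (2 * z) + u * z + v * z by ring.
by rewrite !lerD.
Qed.

Lemma corner_b_step y : corner_b (y * D * y^-1)%g <= M * (corner_a y * corner_b y).
Proof.
rewrite /corner_b (conj_diag_max y N Dl) qabsN.
exact/rowform_diag_le/formmx_pen_pen.
Qed.

Lemma corner_c_step y : corner_c (y * D * y^-1)%g <= M * (corner_c y * corner_d y).
Proof.
rewrite /corner_c (conj_diag_pen y X Dl) qabsN.
exact/rowform_diag_le/formmx_max_max.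
Qed.

(** Two different rows are paired here, so the form with weights 1 has the value [-1] and
    subtracting it gains nothing. Keeping the moduli 1, [r], [r^-1] gives a bound close to [r] once
    [rt_bc y] is small, because [rt_ad y <= 1 + rt_bc y]. *)
Lemma corner_a_step y : corner_a (y * D * y^-1)%g <=
  2 * (rt_ad y * rt_bc y) + r * rt_ad y ^+ 2 + r^-1 * rt_bc y ^+ 2.
Proof.
rewrite /corner_a (conj_diag_pen y N Dl) qabsN rt_ad_sqr rt_bc_sqr.
apply: le_trans (@ler_rowform _ _ _ _ 1 _) _ => [k kp|]; first by rewrite l1.
by rewrite mul1r lN lX !lerD// pen_max_norm.
Qed.

Lemma corner_d_step y : corner_d (y * D * y^-1)%g <=
  2 * (rt_ad y * rt_bc y) + r * rt_bc y ^+ 2 + r^-1 * rt_ad y ^+ 2.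
Proof.
rewrite /corner_d (conj_diag_max y X Dl) qabsN rt_ad_sqr rt_bc_sqr.
apply: le_trans (@ler_rowform _ _ _ _ 1 _) _ => [k kp|]; first by rewrite l1.
rewrite mul1r lN lX !lerD//.
- apply: le_trans (pen_max_norm y); apply: ler_sum => k _; by rewrite mulrC.
- by rewrite [_ * qabs (sp_val y N X)]mulrC.
- by rewrite [_ * qabs (sp_val y N N)]mulrC.
Qed.

Lemma rt_bc_step y : rt_bc (y * D * y^-1)%g <= M * (rt_ad y * rt_bc y).
Proof.
move: (corner_b_step y) (corner_c_step y); move: (y * D * y^-1)%g => z zb zc.
have s0 : 0 <= M * (rt_ad y * rt_bc y).
  exact: mulr_ge0 step_M_ge0 (mulr_ge0 (rt_ad_ge0 y) (rt_bc_ge0 y)).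
rewrite -(ler_pXn2r (n := 2) isT (rt_bc_ge0 z) s0) rt_bc_sqr.
apply: le_trans (ler_pM (corner_b_ge0 _) (corner_c_ge0 _) zb zc) _.
have -> : (M * (rt_ad y * rt_bc y)) ^+ 2 = M ^+ 2 * (rt_ad y ^+ 2 * rt_bc y ^+ 2) by ring.
rewrite (rt_ad_sqr y) (rt_bc_sqr y) le_eqVlt; apply/orP; left; apply/eqP.
by move: (corner_a y) (corner_b y) (corner_c y) (corner_d y) => s t u v; ring.
Qed.

End Step.
End Corner.

(** * Iteration *)

Lemma geometric_small (R : realType) (q A e : R) : 0 <= q < 1 -> 0 < e ->
  \forall k \near \oo, A * q ^+ k < e.
Proof.
move=> /andP[q0 q1] e0.
have /cvgr0_norm_lt : (fun k => A * q ^+ k) @ \oo --> (0 : R).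
  rewrite -(mulr0 A); apply: cvgMr; apply: cvg_expr; by rewrite ger0_norm.
move=> /(_ e e0); apply: filterS => k; exact: le_lt_trans (ler_norm _).
Qed.

(** The factor [m * (1 + L * q ^+ k)] eventually drops below the midpoint [s] of [m] and 1, and from
    then on the decay is geometric with ratio [s]. *)
Lemma perturbed_geometric_small (R : realType) (m L q e : R) (u : nat -> R) :
  0 <= m < 1 -> 0 <= q < 1 -> 0 <= L -> (forall k, 0 <= u k) ->
  (forall k, u k.+1 <= m * (1 + L * q ^+ k) * u k) -> 0 < e ->
  \forall k \near \oo, u k < e.
Proof.
move=> /andP[m0 m1] q01 L0 u0 us e0; pose s := (1 + m) / 2.
have s01 : 0 <= s < 1 by rewrite /s; apply/andP; split; lra.
have d0 : 0 < (1 - m) / 2 by lra.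
have [n _ Hn] := geometric_small L q01 d0.
have un j : u (n + j)%N <= u n * s ^+ j.
  elim: j => [|j IH]; first by rewrite addn0 expr0 mulr1.
  rewrite addnS exprS; apply: le_trans (us _) _.
  have h := Hn (n + j)%N (leq_addr _ _).
  apply: le_trans (_ : s * u (n + j)%N <= _); last first.
    by rewrite mulrCA ler_wpM2l//; case/andP: s01.
  rewrite ler_wpM2r//.
  apply: le_trans (_ : m + L * q ^+ (n + j) <= _); last by move: h; rewrite /s /=; lra.
  rewrite mulrDr mulr1 lerD2l ler_piMl ?(ltW m1)// mulr_ge0// exprn_ge0//.
  by case/andP: q01.
have [N _ HN] := geometric_small (u n) s01 e0.
exists (n + N)%N => // k /= nk.
rewrite -(subnKC (leq_trans (leq_addr N n) nk)).
by apply: le_lt_trans (un _) (HN _ _); rewrite /= leq_subRL// (leq_trans (leq_addr N n)).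
Qed.

Section Iteration.
Variables (R : realType) (p : nat).
Local Notation H := (quat R).
Local Notation Sp := (Sp R p).
Local Notation N := (pen_ord p).
Local Notation X := (ord_max : 'I_p.+2).
Variables (D : Sp) (l : 'rV[H]_p.+2) (r d M : R).
Hypothesis Dl : sp_val D = diag_mx l.
Hypothesis l1 : forall i : 'I_p.+2, (i < p)%N -> qabs (l 0 i) = 1.
Hypothesis lN : qabs (l 0 N) = r.
Hypothesis lX : qabs (l 0 X) = r^-1.
Hypothesis ld : forall i : 'I_p.+2, (i < p)%N -> qabs (l 0 i - 1) <= d.
Hypothesis d0 : 0 <= d.
Hypothesis ME : M = 2 * d + qabs (l 0 N - 1) + qabs (l 0 X - 1).
Hypothesis r0 : 0 < r.
Variable y : nat -> Sp.
Hypothesis yS : forall k, y k.+1 = (y k * D * (y k)^-1)%g.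
Hypothesis y0 : M * (1 + rt_bc (y 0%N)) < 1 \/ M * (1 + rt_ad (y 0%N)) < 1.

Let M0 : 0 <= M. Proof. exact: step_M_ge0 d0 ME. Qed.

Let rt_bcS k : rt_bc (y k.+1) <= M * (rt_ad (y k) * rt_bc (y k)).
Proof. by rewrite yS; exact: rt_bc_step Dl ld d0 ME _. Qed.

Let rho := M * (1 + rt_bc (y 1%N)).

(** The two hypotheses merge here. With [x = rt_bc (y 0)] and [s = rt_ad (y 0)], the new value is at
    most [M * (s * x)]. Under the first hypothesis [s <= 1 + x] makes this at most [x]; under the
    second [x <= 1 + s] makes it at most [s]. *)
Let rho01 : 0 <= rho < 1.
Proof.
apply/andP; split; first by rewrite mulr_ge0 ?addr_ge0 ?rt_bc_ge0.
have := rt_bcS 0; have := rt_ad_le (y 0%N); have := rt_bc_le (y 0%N).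
have := rt_ad_ge0 (y 0%N); have := rt_bc_ge0 (y 0%N).
move: y0 M0; rewrite /rho; move: (rt_ad _) (rt_bc (y 0%N)) (rt_bc (y 1%N)) => s x t.
move=> h m0 x0 s0 xs sx tM.
case: h => h.
  suff tx : t <= x by apply: le_lt_trans h; rewrite ler_wpM2l// lerD2l.
  apply: le_trans tM _; rewrite mulrA ler_piMl//.
  by apply: le_trans (ltW h); rewrite ler_wpM2l.
suff tx : t <= s by apply: le_lt_trans h; rewrite ler_wpM2l// lerD2l.
apply: le_trans tM _; rewrite [s * x]mulrC mulrA ler_piMl//.
by apply: le_trans (ltW h); rewrite ler_wpM2l.
Qed.

Let x1 := rt_bc (y 1%N).

(** As long as the value stays below [x1], the factor [M * rt_ad] of the next step is at most
    [M * (1 + x1) = rho]. *)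
Lemma rt_bc_geometric k : rt_bc (y k.+1) <= x1 * rho ^+ k.
Proof.
have [q0 q1] := andP rho01; have x10 : 0 <= x1 by exact: rt_bc_ge0.
elim: k => [|k IH]; first by rewrite expr0 mulr1.
have kx : rt_bc (y k.+1) <= x1.
  by apply: le_trans IH _; rewrite ler_piMr// exprn_ile1// ltW.
rewrite exprS [x1 * _]mulrCA; apply: le_trans (ler_wpM2l q0 IH).
apply: le_trans (rt_bcS _) _; rewrite mulrA.
rewrite ler_wpM2r ?rt_bc_ge0// /rho ler_wpM2l//.
by apply: le_trans (rt_ad_le _) _; rewrite lerD2l.
Qed.

Let K := x1 * ((2 + x1) * (2 + r + r^-1)).

Let K0 : 0 <= K.
Proof. by rewrite !mulr_ge0 ?addr_ge0 ?invr_ge0 ?rt_bc_ge0// ltW. Qed.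

(** Everything beyond the leading [t] carries a factor [x]. The constant is symmetric in [t] and
    [t^-1], so the same [K] serves [corner_a] with [t = r] and [corner_d] with [t = r^-1]. *)
Let corner_bound (t s x e : R) : 0 < t -> 0 <= s -> 0 <= x -> s <= 1 + x ->
  0 <= e <= 1 -> x <= x1 * e ->
  2 * (s * x) + t * s ^+ 2 + t^-1 * x ^+ 2 <=
  t + x1 * ((2 + x1) * (2 + t + t^-1)) * e.
Proof.
move=> t0 s0 x0 sx /andP[e0 e1] xe.
have x10 : 0 <= x1 by exact: rt_bc_ge0.
have i0 : 0 < t^-1 by rewrite invr_gt0.
have xx1 : x <= x1 by apply: le_trans xe _; rewrite ler_piMr.
apply: le_trans (_ : t + (x1 * e) * ((2 + x1) * (2 + t + t^-1)) <= _); last first.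
  by rewrite mulrAC.
apply: le_trans (_ : t + x * ((2 + x1) * (2 + t + t^-1)) <= _); last first.
  by rewrite lerD2l ler_wpM2r// mulr_ge0 ?addr_ge0// ltW.
apply: le_trans (_ : 2 * ((1 + x) * x) + t * (1 + x) ^+ 2 + t^-1 * x ^+ 2 <= _).
  rewrite !lerD//; first by rewrite ler_pM2l// ler_wpM2r.
  by rewrite ler_pM2l// ler_pXn2r ?nnegrE// addr_ge0.
have -> : 2 * ((1 + x) * x) + t * (1 + x) ^+ 2 + t^-1 * x ^+ 2 =
  t + x * (2 * (1 + x) + t * (2 + x) + t^-1 * x) by ring.
rewrite lerD2l ler_wpM2l//.
have -> : (2 + x1) * (2 + t + t^-1) = 2 * (2 + x1) + t * (2 + x1) + t^-1 * (2 + x1) by ring.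
rewrite !lerD//; first by rewrite ler_pM2l//; lra.
- by rewrite ler_pM2l//; lra.
- by rewrite ler_pM2l//; lra.
Qed.

Let e01 k : 0 <= rho ^+ k <= 1.
Proof. by have [q0 q1] := andP rho01; rewrite exprn_ge0// exprn_ile1// ltW. Qed.

Lemma corner_a_bound k : corner_a (y k.+2) <= r + K * rho ^+ k.
Proof.
rewrite yS; apply: le_trans (corner_a_step Dl l1 lN lX _) _.
apply: corner_bound => //; [exact: rt_ad_ge0|exact: rt_bc_ge0|exact: rt_ad_le|].
exact: rt_bc_geometric.
Qed.

Lemma corner_d_bound k : corner_d (y k.+2) <= r^-1 + K * rho ^+ k.
Proof.
rewrite yS; apply: le_trans (corner_d_step Dl l1 lN lX _) _.
have := @corner_bound r^-1 (rt_ad (y k.+1)) (rt_bc (y k.+1)) (rho ^+ k).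
rewrite invrK invr_gt0 => /(_ r0 (rt_ad_ge0 _) (rt_bc_ge0 _) (rt_ad_le _) (e01 k)
    (rt_bc_geometric k)).
by rewrite addrAC [2 + r^-1 + r]addrAC.
Qed.

Let M01 : 0 <= M < 1.
Proof.
rewrite M0 /=; have [_] := andP rho01; apply: le_lt_trans.
by rewrite /rho ler_peMr// lerDl rt_bc_ge0.
Qed.

(** One step multiplies b by at most [M * corner_a], and [corner_a] is at most [r] up to a geometric
    error; division by [r ^+ k] leaves the factor [M * (1 + K / r * rho ^+ k)]. *)
Lemma corner_b_small e : 0 < e -> \forall k \near \oo, corner_b (y k.+2) / r ^+ k < e.
Proof.
have rn k : 0 < r ^+ k by rewrite exprn_gt0.
apply: (@perturbed_geometric_small _ M (K / r) rho) => //.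
- by rewrite divr_ge0// ltW.
- by move=> k; rewrite divr_ge0 ?corner_b_ge0// ltW.
move=> k; rewrite ler_pdivrMr// (yS k.+2).
apply: le_trans (corner_b_step Dl ld d0 ME _) _.
have -> : M * (1 + K / r * rho ^+ k) * (corner_b (y k.+2) / r ^+ k) * r ^+ k.+1 =
  M * ((r + K * rho ^+ k) * corner_b (y k.+2)).
  rewrite exprS; move: (r ^+ k) (rn k) => t t0; field.
  by rewrite ?(gt_eqF t0) ?(gt_eqF r0).
by rewrite ler_wpM2l// ler_wpM2r ?corner_b_ge0 ?corner_a_bound.
Qed.

Lemma corner_c_small e : 0 < e -> \forall k \near \oo, corner_c (y k.+2) * r ^+ k < e.
Proof.
have rn k : 0 < r ^+ k by rewrite exprn_gt0.
apply: (@perturbed_geometric_small _ M (K * r) rho) => //.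
- by rewrite mulr_ge0// ltW.
- by move=> k; rewrite mulr_ge0 ?corner_c_ge0// ltW.
move=> k; rewrite -ler_pdivlMr// (yS k.+2).
apply: le_trans (corner_c_step Dl ld d0 ME _) _.
have -> : M * (1 + K * r * rho ^+ k) * (corner_c (y k.+2) * r ^+ k) / r ^+ k.+1 =
  M * (corner_c (y k.+2) * (r^-1 + K * rho ^+ k)).
  rewrite exprS; move: (r ^+ k) (rn k) => t t0; field.
  by rewrite ?(gt_eqF t0) ?(gt_eqF r0).
by rewrite ler_wpM2l// ler_wpM2l ?corner_c_ge0 ?corner_d_bound.
Qed.

(** The exponent [k.*2] is what conjugation by the [k]-th power of [g] can absorb. The offset 2
    arises because the geometric bound starts at [y 1] and controls a and d one step later. *)
Lemma corner_sequence : exists B : R, forall e, 0 < e -> exists k,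
  [/\ corner_a (y k.*2.+2) <= B, corner_d (y k.*2.+2) <= B,
      corner_b (y k.*2.+2) / r ^+ k.*2 < e & corner_c (y k.*2.+2) * r ^+ k.*2 < e].
Proof.
exists (r + r^-1 + K) => e e0.
have [k _ Hk] := filterI (corner_b_small e0) (corner_c_small e0).
have [hb hc] := Hk k.*2 (leq_trans (leq_addr k k) (eq_leq (addnn k))).
have Ke : K * rho ^+ k.*2 <= K by rewrite ler_piMr//; case/andP: (e01 k.*2).
have i0 : 0 < r^-1 by rewrite invr_gt0.
exists k; split=> //.
- by apply: le_trans (corner_a_bound _) _; rewrite lerD// lerDl ltW.
- by apply: le_trans (corner_d_bound _) _; rewrite lerD// lerDr ltW.
Qed.

End Iteration.

(** * The stabilizer of the pair of fixed points *)

Lemma sqr_conj (G : groupType) (x y : G) :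
  (x ^+ 2 * y^-1 = y^-1 * ((y * x * y^-1) * (y * x * y^-1)))%g.
Proof. by rewrite !mulgA mulVg mul1g mulgVK expg2. Qed.

Section Stabilizer.
Variables (R : realType) (p : nat).
Local Notation H := (quat R).
Local Notation Sp := (Sp R p).
Local Notation N := (pen_ord p).
Local Notation X := (ord_max : 'I_p.+2).
Implicit Types (x y z : Sp) (l : 'rV[H]_p.+2).

Lemma ler_term_sum (P : pred 'I_p.+2) (F : 'I_p.+2 -> R) (i : 'I_p.+2) :
  (forall k, 0 <= F k) -> P i -> F i <= \sum_(k | P k) F k.
Proof. by move=> F0 Pi; rewrite (bigD1 i)//= lerDl sumr_ge0. Qed.

(** The null last rows are controlled by their corner entries, and the columns by their entries in
    those two rows. In every case the square of an entry is at most [1 + 4 * B ^+ 2], hence at most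
    [(1 + 2 * B) ^+ 2]. *)
Lemma Sp_entry_le y (B : R) : corner_a y <= B -> corner_b y <= B -> corner_c y <= B ->
    corner_d y <= B ->
  forall i j, qabs (sp_val y i j) <= 1 + 2 * B.
Proof.
rewrite /corner_a /corner_b /corner_c /corner_d; move: (pen_norm y) (max_norm y).
rewrite /corner_a /corner_b /corner_c /corner_d; move=> pn mn aB bB cB dB.
have a0 := qabs_ge0 (sp_val y N N); have b0 := qabs_ge0 (sp_val y N X).
have c0 := qabs_ge0 (sp_val y X N); have d0 := qabs_ge0 (sp_val y X X).
have B0 : 0 <= B := le_trans a0 aB.
have B10 : 0 <= 1 + 2 * B by rewrite addr_ge0// mulr_ge0.
have sqB s t : 0 <= s -> 0 <= t -> s <= B -> t <= B -> 2 * (s * t) <= 2 * B ^+ 2.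
  by move=> s0 t0 sB tB; rewrite ler_pM2l// expr2 ler_pM.
have sqrt_le (q : H) : qabs q ^+ 2 <= 1 + 4 * B ^+ 2 -> qabs q <= 1 + 2 * B.
  move=> h; rewrite -(ler_pXn2r (n := 2) isT (qabs_ge0 q) B10).
  apply: le_trans h _; have -> : (1 + 2 * B) ^+ 2 = 1 + 4 * B ^+ 2 + 4 * B by ring.
  by rewrite lerDl mulr_ge0.
have B2 : 0 <= B ^+ 2 := sqr_ge0 B.
have col (i j : 'I_p.+2) : (i < p)%N -> qabs (sp_val y i j) ^+ 2 <=
    qre (formmx R p j j) + 2 * (qabs (sp_val y N j) * qabs (sp_val y X j)).
  move=> ip; apply: le_trans (col_norm y j).
  exact: (ler_term_sum (F := fun k => qabs (sp_val y k j) ^+ 2) (fun k => sqr_ge0 _) ip).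
have row1 (j : 'I_p.+2) : (j < p)%N -> qabs (sp_val y N j) ^+ 2 <= 2 * B ^+ 2.
  move=> jp; apply: le_trans (sqB _ _ a0 b0 aB bB); apply: le_trans pn.
  exact: (ler_term_sum (F := fun k => qabs (sp_val y N k) ^+ 2) (fun k => sqr_ge0 _) jp).
have row2 (j : 'I_p.+2) : (j < p)%N -> qabs (sp_val y X j) ^+ 2 <= 2 * B ^+ 2.
  move=> jp; apply: le_trans (sqB _ _ c0 d0 cB dB); apply: le_trans mn.
  exact: (ler_term_sum (F := fun k => qabs (sp_val y X k) ^+ 2) (fun k => sqr_ge0 _) jp).
have corner q : qabs q <= B -> qabs (q : H) <= 1 + 2 * B by lra.
move=> i j; case: (ord_cases i) => [ip|->|->]; case: (ord_cases j) => [jp|->|->];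
  do ?exact: corner; apply: sqrt_le.
- apply: le_trans (col i j ip) _; rewrite formmx_low// eqxx /=.
  have := row1 j jp; have := row2 j jp; have :=
      sqr_ge0 (qabs (sp_val y N j) - qabs (sp_val y X j)).
  rewrite sqrrB -mulr_natl; lra.
- apply: le_trans (col i N ip) _; rewrite formmx_pen_pen /= add0r.
  by apply: le_trans (sqB _ _ a0 c0 aB cB) _; lra.
- apply: le_trans (col i X ip) _; rewrite formmx_max_max /= add0r.
  by apply: le_trans (sqB _ _ b0 d0 bB dB) _; lra.
- by apply: le_trans (row1 j jp) _; lra.
- by apply: le_trans (row2 j jp) _; lra.
Qed.

Lemma Sp_diagX (D : Sp) l k : sp_val D = diag_mx l ->
  exists2 m : 'rV[H]_p.+2, sp_val (D ^+ k)%g = diag_mx m &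
    forall i, qabs (m 0 i) = qabs (l 0 i) ^+ k.
Proof.
move=> Dl; elim: k => [|k [m Dm mE]].
  exists (const_mx 1); first by rewrite expg0 sp_val1 diag_const_mx.
  by move=> i; rewrite mxE qabs1 expr0.
exists (\row_i (l 0 i * m 0 i)).
  by rewrite expgS sp_valM Dm Dl mulmx_diag.
by move=> i; rewrite mxE qabsM mE exprS.
Qed.

Lemma diag_conj_entry (x w y : Sp) m i j : sp_val x = diag_mx m -> (x * w = y * x)%g ->
  qabs (m 0 i) * qabs (sp_val w i j) = qabs (sp_val y i j) * qabs (m 0 j).
Proof.
move=> xm e; have : sp_val x *m sp_val w = sp_val y *m sp_val x.
  by rewrite -!sp_valM e.
rewrite xm => /(congr1 (fun A : 'M[H]_p.+2 => A i j)).
by rewrite mul_diag_mxE mul_mx_diagE => /(congr1 (@qabs R)); rewrite !qabsM.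
Qed.

(* For [y] in Sp(n,1) these conditions on the corner entries mean that [y]
   fixes, respectively exchanges, the ends of the axis of the diagonal matrices. *)
Definition preserves y : Prop :=
  (corner_b y = 0 /\ corner_c y = 0) \/ (corner_a y = 0 /\ corner_d y = 0).

Lemma qabs0_eq0 (q : H) : qabs q = 0 -> q = 0.
Proof. by move/eqP; rewrite qabs_eq0 => /eqP. Qed.

(** The column is null, so the squared length of its first entries is at most twice the product of
    its last two moduli. *)
Lemma col_low0 y (i j : 'I_p.+2) : formmx R p j j = 0 ->
  qabs (sp_val y N j) * qabs (sp_val y X j) = 0 -> (i < p)%N -> sp_val y i j = 0.
Proof.
move=> Jjj y0 ip; apply: qabs0_eq0; apply/eqP; rewrite -sqrf_eq0 eq_le sqr_ge0 andbT.
have := col_norm y j; rewrite Jjj y0 mulr0 /= addr0; apply: le_trans.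
exact: (ler_term_sum (F := fun k => qabs (sp_val y k j) ^+ 2) (fun k => sqr_ge0 _) ip).
Qed.

Lemma preserves_pen y (i : 'I_p.+2) : preserves y -> (i < p)%N -> sp_val y i N = 0.
Proof.
rewrite /preserves /corner_a /corner_b /corner_c /corner_d => h; apply: col_low0;
    first exact: formmx_pen_pen.
by case: h => -[h1 h2]; rewrite ?h1 ?h2 ?mulr0 ?mul0r.
Qed.

Lemma preserves_max y (i : 'I_p.+2) : preserves y -> (i < p)%N -> sp_val y i X = 0.
Proof.
rewrite /preserves /corner_a /corner_b /corner_c /corner_d => h; apply: col_low0;
    first exact: formmx_max_max.
by case: h => -[h1 h2]; rewrite ?h1 ?h2 ?mulr0 ?mul0r.
Qed.

Lemma mulmx_pen_max n (A : 'M[H]_(n, p.+2)) (B : 'M[H]_p.+2) i j :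
  (forall k : 'I_p.+2, (k < p)%N -> B k j = 0) ->
  (A *m B) i j = A i N * B N j + A i X * B X j.
Proof.
move=> B0; rewrite mxE sum_pen_max big1 ?add0r// => k kp.
by rewrite B0 ?mulr0.
Qed.

Lemma corner_mul x y : preserves y ->
  [/\ sp_val (x * y)%g N N = sp_val x N N * sp_val y N N + sp_val x N X * sp_val y X N,
      sp_val (x * y)%g N X = sp_val x N N * sp_val y N X + sp_val x N X * sp_val y X X,
      sp_val (x * y)%g X N = sp_val x X N * sp_val y N N + sp_val x X X * sp_val y X N &
      sp_val (x * y)%g X X = sp_val x X N * sp_val y N X + sp_val x X X * sp_val y X X].
Proof.
move=> yp; rewrite sp_valM.
by split; apply: mulmx_pen_max => k kp; rewrite ?(preserves_pen yp) ?(preserves_max yp).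
Qed.

Lemma preservesP y : preserves y <->
  (sp_val y N X = 0 /\ sp_val y X N = 0) \/ (sp_val y N N = 0 /\ sp_val y X X = 0).
Proof.
rewrite /preserves /corner_a /corner_b /corner_c /corner_d; split.
  by case=> -[/qabs0_eq0 h1 /qabs0_eq0 h2]; [left|right].
by case=> -[-> ->]; rewrite qabs0; [left|right].
Qed.

Lemma preserves_mul x y : preserves x -> preserves y -> preserves (x * y)%g.
Proof.
move=> xp yp; apply/preservesP; have [-> -> -> ->] := corner_mul x yp.
move: xp yp => /preservesP xp /preservesP yp.
case: xp yp => -[-> ->] [|] [-> ->];
  rewrite ?(mulr0, mul0r, addr0, add0r); first [by left | by right].
Qed.

Lemma preserves_sqr y : preserves y -> corner_b (y * y)%g = 0 /\ corner_c (y * y)%g = 0.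
Proof.
move=> yp; rewrite /corner_b /corner_c; have [_ -> -> _] := corner_mul y yp.
by move: yp => /preservesP[] [-> ->]; rewrite ?(mulr0, mul0r, addr0) qabs0.
Qed.

Lemma corner_inv y :
  [/\ corner_a y^-1%g = corner_d y, corner_b y^-1%g = corner_b y, corner_c y^-1%g =
      corner_c y & corner_d y^-1%g = corner_a y].
Proof.
rewrite /corner_a /corner_b /corner_c /corner_d Sp_inv_pen_pen Sp_inv_pen_max
    Sp_inv_max_pen Sp_inv_max_max.
by rewrite !qabs_conj.
Qed.

Lemma preserves_inv y : preserves y -> preserves y^-1%g.
Proof.
rewrite /preserves; have [-> -> -> ->] := corner_inv y.
by case=> -[-> ->]; [left|right].
Qed.

Lemma preserves_diag y l : sp_val y = diag_mx l -> corner_b y = 0 /\ corner_c y = 0.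
Proof.
have d0 (i j : 'I_p.+2) : i != j -> diag_mx l i j = 0.
  by rewrite mxE => /negPf ->; rewrite mulr0n.
have NX := pen_neq_max p; have XN : X != N by rewrite eq_sym.
by move=> yl; rewrite /corner_b /corner_c yl (d0 _ _ NX) (d0 _ _ XN) qabs0.
Qed.

Lemma preserves_mulmx (w z : Sp) : corner_b z = 0 -> corner_c z = 0 ->
  [/\ qabs (sp_val (w * z)%g N N) = corner_a w * corner_a z, qabs (sp_val (w * z)%g N X) =
      corner_b w * corner_d z,
      qabs (sp_val (w * z)%g X N) = corner_c w * corner_a z & qabs (sp_val (w * z)%g X X) =
          corner_d w * corner_d z].
Proof.
move=> zb zc; have zp : preserves z by left.
have [c1 c2 c3 c4] := corner_mul w zp.
rewrite (qabs0_eq0 zb) in c2; rewrite (qabs0_eq0 zc) in c1.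
rewrite (qabs0_eq0 zc) in c3; rewrite (qabs0_eq0 zb) in c4.
split; [rewrite c1|rewrite c2|rewrite c3|rewrite c4];
  by rewrite ?mulr0 ?addr0 ?add0r qabsM.
Qed.

(* A null line fixed by a loxodromic diagonal matrix is spanned by one of the
   last two basis vectors; here the lines are the last two columns of [w]. *)
Lemma diag_fixed_columns (x w z : Sp) m : sp_val x = diag_mx m ->
  qabs (m 0 N) != qabs (m 0 X) -> corner_b z = 0 -> corner_c z = 0 -> (x * w = w * z)%g ->
  (corner_a w = 0 \/ corner_c w = 0) /\ (corner_b w = 0 \/ corner_d w = 0).
Proof.
move=> xm mNX zb zc e; have [c1 c2 c3 c4] := preserves_mulmx w zb zc.
have E i j : qabs (m 0 i) * qabs (sp_val w i j) = qabs (sp_val (w * z)%g i j).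
  by rewrite -e sp_valM xm mul_diag_mxE qabsM.
(* If both coordinates of a column were nonzero, its scaling factor [u] would equal both eigenvalue
   moduli. *)
have key (s t u : R) : qabs (m 0 N) * s = s * u -> qabs (m 0 X) * t = t * u -> s = 0 \/ t = 0.
  move=> h1 h2; have [->|s0] := eqVneq s 0; first by left.
  have [->|t0] := eqVneq t 0; first by right.
  case/eqP: mNX; transitivity u.
    by apply: (mulIf s0); rewrite h1 mulrC.
  by apply: (mulIf t0); rewrite h2 mulrC.
by split; [exact: key (etrans (E N N) c1) (etrans (E X N) c3)
          |exact: key (etrans (E N X) c2) (etrans (E X X) c4)].
Qed.

(** The square of [z = y D y^-1] fixes both ends even if [z] exchanges them. As
    [D^2 y^-1 = y^-1 z^2], the last two columns of [y^-1] span lines fixed by [D^2], so each is one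
    of the two ends. *)
Lemma preserves_conj (D y : Sp) l r : sp_val D = diag_mx l ->
  qabs (l 0 N) = r -> qabs (l 0 X) = r^-1 -> 0 < r -> r != 1 ->
  preserves (y * D * y^-1)%g -> preserves y.
Proof.
move=> Dl lN lX r0 r1 zp.
have [Zb Zc] := preserves_sqr zp.
have [m Dm mE] := Sp_diagX 2 Dl.
have mNX : qabs (m 0 N) != qabs (m 0 X).
  rewrite !mE lN lX; apply: contra r1 => /eqP h; have : (r ^+ 2) ^+ 2 = 1.
    by rewrite {1}expr2 {1}h -exprMn mulVf ?expr1n// gt_eqF.
  move=> r4; rewrite -(eqrXn2 (n := 4)) ?(ltW r0)//.
  by rewrite (exprM r 2 2) r4 expr1n.
have [h1 h2] := diag_fixed_columns Dm mNX Zb Zc (sqr_conj D y).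
have [ia ib ic id] := corner_inv y; rewrite ia ic in h1; rewrite ib id in h2.
(* This rules out that both columns give the same end. *)
have h0 : ~ (corner_a y * corner_d y = 0 /\ corner_b y * corner_c y = 0).
  move=> [e1 e2]; have := rt_ad_bc_ge1 y.
  by rewrite /rt_ad /rt_bc e1 e2 sqrtr0 addr0 ler10.
case: h1 h2 => h1 [] h2.
- by case: h0; rewrite h1 h2 mulr0 mul0r.
- by right.
- by left.
- by case: h0; rewrite h1 h2 mulr0 mul0r.
Qed.

End Stabilizer.

(** * Action on projective points *)

Section Projective.
Variables (R : realType) (p : nat).
Local Notation H := (quat R).
Local Notation V := ('cV[quat R]_p.+2).
Local Notation Sp := (Sp R p).
Local Notation J := (formmx R p).
Local Notation N := (pen_ord p).
Local Notation X := (ord_max : 'I_p.+2).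
Local Notation e_ j := (delta_mx j 0 : V).
Implicit Types (f y a : Sp) (z w : V) (q : H).

Lemma mul_delta_cE m (A : 'M[H]_(m, p.+2)) i j : (A *m e_ j) i 0 = A i j.
Proof. by rewrite -colE mxE. Qed.

Lemma mul_scalar_cE z q i : (z *m q%:M) i 0 = z i 0 * q.
Proof. by rewrite mxE big_ord1 mxE eqxx mulr1n. Qed.

Lemma herm_Sp f z w : herm (sp_val f *m z) (sp_val f *m w) = herm z w.
Proof.
rewrite /herm adjmxM.
have -> : adjmx w *m adjmx f *m J *m (sp_val f *m z) =
    adjmx w *m (adjmx f *m J *m sp_val f) *m z by rewrite !mulmxA.
by rewrite (eqP (spP f)).
Qed.

Lemma herm_conj z w : herm w z = qconj (herm z w).
Proof.
have -> : qconj (herm z w) = adjmx (adjmx w *m J *m z) 0 0 by rewrite mxE mxE.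
by rewrite !adjmxM adjmxK adj_formmx mulmxA.
Qed.

Lemma qabs_hermC z w : qabs (herm w z) = qabs (herm z w).
Proof. by rewrite herm_conj qabs_conj. Qed.

Lemma herm_scale z w q r :
  herm (z *m q%:M) (w *m r%:M) = qconj r * herm z w * q.
Proof.
rewrite /herm mulmxA mxE big_ord1 [q%:M _ _]mxE eqxx mulr1n; congr (_ * q).
rewrite adjmxM -!mulmxA mxE big_ord1; congr (_ * _).
by rewrite !mxE eqxx mulr1n.
Qed.

Lemma qabs_herm_pen z : qabs (herm (e_ N) z) = qabs (z X 0).
Proof. by rewrite /herm mul_delta_cE mulmxJ_pen qabsN !mxE qabs_conj. Qed.

Lemma qabs_herm_max z : qabs (herm (e_ X) z) = qabs (z N 0).
Proof. by rewrite /herm mul_delta_cE mulmxJ_max qabsN !mxE qabs_conj. Qed.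

Lemma projpt_lift z : exists2 q, q != 0 & lift_pt (projpt z) = z *m q%:M.
Proof.
have [|q q0 qz] := @xgetPex _ 0 (projpt z); last by exists q.
by exists (z *m 1%:M); exists 1 => //=; exact: oner_neq0.
Qed.

Lemma Sp_act_projpt f z : Sp_act f (projpt z) = projpt (sp_val f *m z).
Proof.
apply/seteqP; split=> x /=.
  by move=> [_ [q q0 <-] <-]; exists q; rewrite //= mulmxA.
by move=> [q q0 <-]; exists (z *m q%:M); [exists q|rewrite mulmxA].
Qed.

Lemma projpt_scale z q : q != 0 -> projpt (z *m q%:M) = projpt z.
Proof.
move=> q0; apply/seteqP; split=> x /= [r /= r0 <-].
  exists (q * r) => /=; last by rewrite scalar_mxM mulmxA.
  by rewrite -qabs_eq0 qabsM mulf_neq0 ?qabs_eq0.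
have uq : q \is a GRing.unit by [].
exists (q^-1 * r) => /=; last by rewrite -mulmxA -scalar_mxM mulrA divrr// mul1r.
by rewrite -qabs_eq0 qabsM qabsV mulf_neq0 ?invr_eq0 ?qabs_eq0.
Qed.

Lemma qabs_cross_ratio (Z1 Z2 W1 W2 : V) :
  qabs (cross_ratio (projpt Z1) (projpt Z2) (projpt W1) (projpt W2)) =
  qabs (herm W1 Z1) * (qabs (herm W1 Z2))^-1 * qabs (herm W2 Z2) *
    (qabs (herm W2 Z1))^-1.
Proof.
rewrite /cross_ratio.
have [q1 q10 ->] := projpt_lift Z1; have [q2 q20 ->] := projpt_lift Z2.
have [r1 r10 ->] := projpt_lift W1; have [r2 r20 ->] := projpt_lift W2.
rewrite !herm_scale !(qabsM, qabsV, qabs_conj, invfM).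
move: q10 q20 r10 r20; rewrite -!qabs_eq0.
move: (qabs q1) (qabs q2) (qabs r1) (qabs r2) => s t u v s0 t0 u0 v0.
move: (qabs (herm W1 Z2))^-1 (qabs (herm W2 Z1))^-1 => A B; field.
by rewrite s0 t0 u0 v0.
Qed.

Lemma mulVmx_Sp a : sp_val a^-1%g *m sp_val a = 1%:M.
Proof. by rewrite -sp_valM mulVg. Qed.

Lemma mulmxV_Sp a : sp_val a *m sp_val a^-1%g = 1%:M.
Proof. by rewrite -sp_valM mulgV. Qed.

Lemma fixes_projpt f a z q : q != 0 -> sp_val (a * f * a^-1)%g *m z = z *m q%:M ->
  Sp_act f (projpt (sp_val a^-1%g *m z)) = projpt (sp_val a^-1%g *m z).
Proof.
move=> q0 fz; rewrite Sp_act_projpt -(projpt_scale (sp_val a^-1%g *m z) q0).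
congr projpt; rewrite -mulmxA -fz !sp_valM.
by rewrite !mulmxA mulVmx_Sp mul1mx.
Qed.

Lemma Vnull_axis a j : (j == N) || (j == X) -> Vnull (sp_val a^-1%g *m e_ j).
Proof.
move=> jNX; split; last first.
  rewrite herm_Sp /herm mul_delta_cE; apply: qabs0_eq0.
  by case/orP: jNX => /eqP ->; rewrite ?mulmxJ_pen ?mulmxJ_max qabsN !mxE qabs_conj
    ?[X == N]eq_sym (negPf (pen_neq_max p)) qabs0.
apply/eqP => /(congr1 (mulmx (sp_val a))).
rewrite mulmx0 mulmxA mulmxV_Sp mul1mx => /matrixP/(_ j 0).
by rewrite !mxE !eqxx => /eqP; rewrite oner_eq0.
Qed.

Lemma bdry_axis a j : (j == N) || (j == X) -> bdry (projpt (sp_val a^-1%g *m e_ j)).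
Proof. by move=> /Vnull_axis h; exists (sp_val a^-1%g *m e_ j). Qed.

Lemma axis_ends_neq a :
  projpt (sp_val a^-1%g *m e_ N) <> projpt (sp_val a^-1%g *m e_ X).
Proof.
move=> h; have : projpt (sp_val a^-1%g *m e_ N) (sp_val a^-1%g *m e_ N).
  by exists 1; rewrite ?mulmx1//=; exact: oner_neq0.
rewrite h => -[q /= q0 /(congr1 (mulmx (sp_val a)))].
rewrite -(mulmxA (sp_val a^-1%g)) 2!(mulmxA (sp_val a)) mulmxV_Sp 2!mul1mx => /matrixP/(_ N 0).
rewrite mul_scalar_cE !mxE !eqxx (negPf (pen_neq_max p)) /= mul0r => /esym/eqP.
by rewrite oner_eq0.
Qed.

Lemma pen_column (y : Sp) : corner_b y = 0 -> corner_c y = 0 ->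
  sp_val y *m e_ N = e_ N *m (sp_val y N N)%:M.
Proof.
move=> yb yc; have yp : preserves y by left.
apply/matrixP => i j; rewrite ord1 mul_delta_cE mul_scalar_cE [e_ N _ _]mxE eqxx andbT.
case: (ord_cases i) => [ip|->|->].
- rewrite (preserves_pen yp ip); case: eqP ip => [->|_ _]; first by rewrite pen_lt.
  by rewrite mul0r.
- by rewrite eqxx mul1r.
- by rewrite (qabs0_eq0 yc) eq_sym (negPf (pen_neq_max p)) mul0r.
Qed.

Lemma max_column (y : Sp) : corner_b y = 0 -> corner_c y = 0 ->
  sp_val y *m e_ X = e_ X *m (sp_val y X X)%:M.
Proof.
move=> yb yc; have yp : preserves y by left.
apply/matrixP => i j; rewrite ord1 mul_delta_cE mul_scalar_cE [e_ X _ _]mxE eqxx andbT.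
case: (ord_cases i) => [ip|->|->].
- rewrite (preserves_max yp ip); case: eqP ip => [->|_ _]; first by rewrite max_lt.
  by rewrite mul0r.
- by rewrite (qabs0_eq0 yb) (negPf (pen_neq_max p)) mul0r.
- by rewrite eqxx mul1r.
Qed.

Lemma corner_diag_neq0 (y : Sp) : corner_b y = 0 -> corner_c y = 0 ->
  sp_val y N N != 0 /\ sp_val y X X != 0.
Proof.
move=> yb yc; have := rt_ad_bc_ge1 y; rewrite /rt_bc yb mul0r sqrtr0 addr0 /rt_ad.
move=> h; split; apply/eqP => y0; move: h; rewrite /corner_a /corner_d y0 qabs0 ?mulr0 ?mul0r.
  by rewrite sqrtr0 ler10.
by rewrite sqrtr0 ler10.
Qed.

Lemma fixes_axis_pen a f : corner_b (a * f * a^-1)%g = 0 -> corner_c (a * f * a^-1)%g = 0 ->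
  Sp_act f (projpt (sp_val a^-1%g *m e_ N)) = projpt (sp_val a^-1%g *m e_ N).
Proof.
move=> fb fc; have [q0 _] := corner_diag_neq0 fb fc.
exact: fixes_projpt q0 (pen_column fb fc).
Qed.

Lemma fixes_axis_max a f : corner_b (a * f * a^-1)%g = 0 -> corner_c (a * f * a^-1)%g = 0 ->
  Sp_act f (projpt (sp_val a^-1%g *m e_ X)) = projpt (sp_val a^-1%g *m e_ X).
Proof.
move=> fb fc; have [_ q0] := corner_diag_neq0 fb fc.
exact: fixes_projpt q0 (max_column fb fc).
Qed.

(* If [y] exchanges the two ends of the axis, with corner entries [b] and [c],
   then [c = b / |b|^2], so that the point of the axis with coordinates
   [(|b|, 1)] is fixed. *)
Lemma swap_fixed_point (y : Sp) : corner_a y = 0 -> corner_d y = 0 ->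
  exists z q, [/\ q != 0, sp_val y *m z = z *m q%:M & qre (herm z z) < 0].
Proof.
move=> ya yd; have yp : preserves y by right.
set b := sp_val y N X; set c := sp_val y X N; set s := qabs b.
have cb1 : qconj c * b = 1.
  have := Sp_col y N X; rewrite (qabs0_eq0 ya) (qabs0_eq0 yd) formmx_pen eqxx.
  rewrite big1 => [|k kp]; last by rewrite (preserves_max yp kp) mulr0.
  by rewrite mulr0 subr0 sub0r => /oppr_inj.
have b0 : b != 0 by apply: contra_eq_neq cb1 => ->; rewrite mulr0 eq_sym oner_neq0.
have s0 : 0 < s by rewrite lt_neqAle eq_sym qabs_eq0 b0 qabs_ge0.
have bc1 : qconj b * c = 1 by rewrite -[c]qconjK -qconjM cb1 qconj1.
(* The modulus |b| as a real quaternion, hence central; its square is [b * qconj b], so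
   [b = t * (c * t)] and the scalar by which [y] acts on [z] is [c * t]. *)
pose t : H := Quat s 0 0 0.
have tC (x : H) : t * x = x * t by apply: quat_ext => /=; ring.
have tt : t * t = b * qconj b.
  have := qconjMx (qconj b); rewrite qconjK qabs_conj -/s => ->.
  by rewrite expr2; apply: quat_ext => /=; ring.
have btct : b = t * (c * t).
  by rewrite mulrA -tC mulrA tt -mulrA bc1 mulr1.
have c0 : c != 0 by apply: contra_eq_neq bc1 => ->; rewrite mulr0 eq_sym oner_neq0.
have t0 : qabs t = s.
  by rewrite qabsE /qnorm2 /= !expr0n /= !addr0 sqrtr_sqr ger0_norm// ltW.
pose z : V := e_ N *m t%:M + e_ X.
have zN : z N 0 = t.
  by rewrite mxE mul_scalar_cE !mxE !eqxx (negPf (pen_neq_max p)) mul1r addr0.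
have zX : z X 0 = 1.
  by rewrite mxE mul_scalar_cE !mxE !eqxx eq_sym (negPf (pen_neq_max p)) mul0r add0r.
have zl (k : 'I_p.+2) : (k < p)%N -> z k 0 = 0.
  move=> kp; rewrite mxE mul_scalar_cE !mxE !eqxx !andbT.
  case: eqP kp => [->|_]; first by rewrite pen_lt.
  by case: eqP => [->|_ _]; rewrite ?max_lt//= mul0r addr0.
exists z, (c * t); split.
- by rewrite -qabs_eq0 qabsM t0 mulf_neq0 ?(gt_eqF s0)// qabs_eq0.
- apply/matrixP => i j; rewrite ord1 mul_scalar_cE mulmxDr mulmxA mxE mul_scalar_cE.
  rewrite !mul_delta_cE; case: (ord_cases i) => [ip|->|->].
  + by rewrite zl// (preserves_pen yp ip) (preserves_max yp ip) !mul0r addr0.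
  + by rewrite zN -btct (qabs0_eq0 ya) mul0r add0r.
  + by rewrite zX mul1r (qabs0_eq0 yd) addr0.
rewrite /herm mulmxJmxE big1 => [|k kp]; last by rewrite zl// mulr0.
rewrite zN zX [adjmx z 0 N]mxE [adjmx z 0 X]mxE ![map_mx _ _ _ _]mxE zN zX qconj1 /=.
rewrite !(mulr0, mul0r, mulr1, mul1r, subr0, sub0r) -opprD oppr_lt0.
exact: addr_gt0.
Qed.

Lemma elliptic_swap a f : corner_a (a * f * a^-1)%g = 0 -> corner_d (a * f * a^-1)%g = 0 ->
    elliptic f.
Proof.
move=> fa fd; split=> [f1|].
  move: fa; rewrite f1 mulg1 mulgV /corner_a sp_val1 mxE eqxx qabs1 => /eqP.
  by rewrite oner_eq0.
have [z [q [q0 zq zz]]] := swap_fixed_point fa fd.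
exists (projpt (sp_val a^-1%g *m z)); last exact: fixes_projpt q0 zq.
by exists (sp_val a^-1%g *m z) => //; have := herm_Sp a^-1%g z z; rewrite /Vneg /= => ->.
Qed.

End Projective.

(** * Proof of the theorem *)

Lemma conj_conj (G : groupType) (a x g : G) :
  (a * (x * g * x^-1) * a^-1 = (a * x * a^-1) * (a * g * a^-1) * (a * x * a^-1)^-1)%g.
Proof. by rewrite !invgM !invgK !mulgA !mulgVK. Qed.

Lemma conj_exp (G : groupType) (a g : G) k : ((a * g * a^-1) ^+ k = a * g ^+ k * a^-1)%g.
Proof.
elim: k => [|k IH]; first by rewrite !expg0 mulg1 mulgV.
by rewrite !expgS IH !mulgA mulgVK.
Qed.

Lemma conj_intertwine (G : groupType) (a s t : G) :
  ((a * s * a^-1) * (a * (s^-1 * t * s) * a^-1) = (a * t * a^-1) * (a * s * a^-1))%g.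
Proof. by rewrite !mulgA !mulgVK mulgK. Qed.

Lemma conj_div (G : groupType) (a s t : G) :
  (a * (s * t^-1) * a^-1 = (a * s * a^-1) * (a * t * a^-1)^-1)%g.
Proof. by rewrite !invgM !invgK !mulgA !mulgVK. Qed.

Lemma scaled_sum_eq0 (R : realFieldType) (s t u : R) : 0 < u -> 0 <= s -> 0 <= t ->
  s / u + t * u <= 0 -> s = 0 /\ t = 0.
Proof.
move=> u0 s0 t0 h; have su : 0 <= s / u by rewrite divr_ge0// ltW.
have tu : 0 <= t * u by rewrite mulr_ge0// ltW.
split; apply/eqP.
  have : s / u == 0 by apply/eqP; lra.
  by rewrite mulf_eq0 invr_eq0 (gt_eqF u0) orbF.
have : t * u == 0 by apply/eqP; lra.
by rewrite mulf_eq0 (gt_eqF u0) orbF.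
Qed.

Section Joergensen.
Variables (R : realType) (p : nat).
Local Notation H := (quat R).
Local Notation V := ('cV[quat R]_p.+2).
Local Notation Sp := (Sp R p).
Local Notation N := (pen_ord p).
Local Notation X := (ord_max : 'I_p.+2).
Local Notation e_ j := (delta_mx j 0 : V).
Implicit Types (f g h a y : Sp) (G : set Sp).

Lemma group_closed_mul G x y : group_closed [in G] -> G x -> G y -> G (x * y)%g.
Proof. by move=> Gg Gx Gy; apply/set_mem/(group_closedM Gg); exact/mem_set. Qed.

Lemma group_closed_inv G x : group_closed [in G] -> G x -> G x^-1%g.
Proof. by move=> Gg Gx; apply/set_mem/(group_closedV Gg)/mem_set. Qed.

Lemma group_closed_exp G x k : group_closed [in G] -> G x -> G (x ^+ k)%g.
Proof.
move=> Gg Gx; elim: k => [|k IH]; first by rewrite expg0; apply/set_mem; case: Gg.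
by rewrite expgS; exact: group_closed_mul.
Qed.

Lemma gen2_group g h : group_closed [in gen2 g h].
Proof.
split=> [|x y /set_mem xG /set_mem yG]; apply/mem_set => G Gg Gg1 Gh1.
  by apply/set_mem; case: Gg.
apply: (group_closed_mul Gg); first exact: xG.
by apply: (group_closed_inv Gg); exact: yG.
Qed.

Lemma gen2_l g h : gen2 g h g. Proof. by move=> G. Qed.

Lemma gen2_r g h : gen2 g h h. Proof. by move=> G. Qed.

Lemma diag_conj_corners (x w y : Sp) (m : 'rV[H]_p.+2) (s : R) :
  sp_val x = diag_mx m -> qabs (m 0 N) = s -> qabs (m 0 X) = s^-1 -> 0 < s ->
  (x * w = y * x)%g ->
  [/\ corner_a w = corner_a y, corner_b w = corner_b y / (s * s), corner_c w =
      corner_c y * (s * s) & corner_d w = corner_d y].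
Proof.
move=> xm mN mX s0 e; have W i j := diag_conj_entry i j xm e.
have sn : s != 0 by rewrite gt_eqF.
move: (W N N) (W N X) (W X N) (W X X).
rewrite !mN !mX -/(corner_a w) -/(corner_b w) -/(corner_c w) -/(corner_d w).
rewrite -/(corner_a y) -/(corner_b y) -/(corner_c y) -/(corner_d y) => wa wb wc wd; split.
- by apply: (mulfI sn); rewrite wa mulrC.
- by apply: (mulfI sn); rewrite wb; field.
- by apply: (mulfI (invr_neq0 sn)); rewrite wc; field.
- by apply: (mulfI (invr_neq0 sn)); rewrite wd mulrC.
Qed.

Lemma preserves_of_discrete G a g h l (r d M : R) :
  group_closed [in G] -> discrete G -> G g -> G h ->
  sp_val (a * g * a^-1)%g = diag_mx l ->
  (forall i : 'I_p.+2, (i < p)%N -> qabs (l 0 i) = 1) ->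
  qabs (l 0 N) = r -> qabs (l 0 X) = r^-1 -> 0 < r -> r != 1 ->
  (forall i : 'I_p.+2, (i < p)%N -> qabs (l 0 i - 1) <= d) -> 0 <= d ->
  M = 2 * d + qabs (l 0 N - 1) + qabs (l 0 X - 1) ->
  M * (1 + rt_bc (a * h * a^-1)%g) < 1 \/ M * (1 + rt_ad (a * h * a^-1)%g) < 1 ->
  preserves (a * h * a^-1)%g.
Proof.
move=> Gg Gd gG hG Dl l1 lN lX r0 r1 ld d0 ME small.
pose hs k := iter k (fun x : Sp => (x * g * x^-1)%g) h.
pose y k := (a * hs k * a^-1)%g.
have hsG k : G (hs k).
  elim: k => [//|k IH]; rewrite /hs iterS -/(hs k).
  apply: (group_closed_mul Gg); last exact: group_closed_inv.
  exact: group_closed_mul.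
have yS k : y k.+1 = (y k * (a * g * a^-1) * (y k)^-1)%g by exact: conj_conj.
have [B HB] := @corner_sequence R p _ l r d M Dl l1 lN lX ld d0 ME r0 y yS small.
have BB : B <= `|B| + 1 by rewrite (le_trans (ler_norm B))// lerDl.
have B1 : 1 <= `|B| + 1 by rewrite lerDr.
pose C := (p.+2 * p.+2)%:R * (1 + 2 * (`|B| + 1)).
have [e e0 He] := discrete_no_small a C
  (fun x => corner_b (a * x * a^-1)%g + corner_c (a * x * a^-1)%g) Gg Gd.
(* The half makes b + c smaller than [e]; the bound 1 keeps the rescaled entries inside the range
   that defines [C]. *)
have e20 : 0 < Num.min (e / 2) 1 by rewrite lt_min ltr01 andbT divr_gt0.
have [k [aB dB]] := HB _ e20; rewrite !lt_min => /andP[be b1] /andP[ce c1].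
(* Its entries b and c are those of [y k.*2.+2] divided and multiplied by [r ^+ k.*2], the rescaling
   for which [corner_sequence] gives smallness. *)
pose x := ((g ^+ k)^-1 * hs k.*2.+2 * g ^+ k)%g.
have xG : G x.
  have gkG := group_closed_exp k Gg gG.
  apply: (group_closed_mul Gg) => //; apply: (group_closed_mul Gg) => //.
  exact: group_closed_inv.
have [m Dm mE] := Sp_diagX k Dl; rewrite conj_exp in Dm.
have inter : ((a * g ^+ k * a^-1) * (a * x * a^-1) = y k.*2.+2 * (a * g ^+ k * a^-1))%g.
  exact: conj_intertwine.
have rk : 0 < r ^+ k by rewrite exprn_gt0.
have mN : qabs (m 0 N) = r ^+ k by rewrite mE lN.
have mX : qabs (m 0 X) = (r ^+ k)^-1 by rewrite mE lX exprVn.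
have [wa wb wc wd] := diag_conj_corners Dm mN mX rk inter.
rewrite -exprD addnn in wb wc.
have xC : mxabs (sp_val (a * x * a^-1)%g) <= C.
  apply: ler_mxabs; apply: Sp_entry_le.
  - by rewrite wa (le_trans aB).
  - by rewrite wb (le_trans (ltW b1)).
  - by rewrite wc (le_trans (ltW c1)).
  - by rewrite wd (le_trans dB).
have lt_e : corner_b (a * x * a^-1)%g + corner_c (a * x * a^-1)%g < e.
  by rewrite wb wc [e]splitr ltrD.
have bc0 := He x xG xC lt_e; rewrite /= wb wc in bc0.
have rr : 0 < r ^+ k.*2 by rewrite exprn_gt0.
have [yb yc] := scaled_sum_eq0 rr (corner_b_ge0 (y k.*2.+2)) (corner_c_ge0 (y k.*2.+2)) bc0.
(* Descent by [preserves_conj] to index 0, where [y 0] is the conjugate of [h]. *)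
have : preserves (y k.*2.+2) := or_introl (conj yb yc).
elim: (k.*2.+2) => [|n IH]; first exact: id.
by rewrite (yS n) => /(preserves_conj Dl lN lX r0 r1)/IH.
Qed.

Lemma gen2_preserves a g h : preserves (a * g * a^-1)%g -> preserves (a * h * a^-1)%g ->
  forall x, gen2 g h x -> preserves (a * x * a^-1)%g.
Proof.
move=> gp hp x /(_ [set x | preserves (a * x * a^-1)%g]); apply => //; split.
  apply/mem_set; rewrite /= mulg1 mulgV; left.
  by apply: (@preserves_diag _ _ _ (const_mx 1)); rewrite diag_const_mx.
move=> s t /set_mem sp /set_mem tp; apply/mem_set; rewrite /= conj_div.
exact: preserves_mul sp (preserves_inv tp).
Qed.

(** An element that exchanges the ends is elliptic, so any two non-elliptic elements share a fixed
    end and their fixed point sets meet. *)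
Lemma preserves_elementary a G : (forall x, G x -> preserves (a * x * a^-1)%g) ->
  elementary G.
Proof.
move=> Gp [f1 [f2 [[G1 G2] [ne1 ne2] _ dis]]].
have fix0 f : G f -> ~ elliptic f -> fixpts f (projpt (sp_val a^-1%g *m e_ N)).
  move=> /Gp[[fb fc]|[fa fd]] nf; last by case: nf; exact: elliptic_swap fa fd.
  split; last exact: fixes_axis_pen.
  by right; apply: bdry_axis; rewrite eqxx.
have : (fixpts f1 `&` fixpts f2) (projpt (sp_val a^-1%g *m e_ N)).
  by split; exact: fix0.
by rewrite dis.
Qed.

(** * The cross-ratios as corner entries *)

Lemma herm_conj_axis a h z w :
  herm (sp_val a^-1%g *m z) (sp_val h *m (sp_val a^-1%g *m w)) =
  herm z (sp_val (a * h * a^-1)%g *m w).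
Proof.
have <- := herm_Sp a (sp_val a^-1%g *m z) (sp_val h *m (sp_val a^-1%g *m w)).
congr herm; first by rewrite mulmxA mulmxV_Sp mul1mx.
by rewrite 2!sp_valM -!mulmxA.
Qed.

Lemma qabs_cross_axis1 a h i j :
  qabs (cross_ratio (Sp_act h (projpt (sp_val a^-1%g *m e_ i)))
    (projpt (sp_val a^-1%g *m e_ j)) (projpt (sp_val a^-1%g *m e_ i))
    (Sp_act h (projpt (sp_val a^-1%g *m e_ j)))) =
  qabs (herm (e_ i) (sp_val (a * h * a^-1)%g *m e_ i)) * (qabs (herm (e_ i) (e_ j)))^-1 *
    qabs (herm (e_ j) (sp_val (a * h * a^-1)%g *m e_ j)) * (qabs (herm (e_ j) (e_ i)))^-1.
Proof.
rewrite !Sp_act_projpt qabs_cross_ratio.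
have h1 := herm_Sp h (sp_val a^-1%g *m e_ j) (sp_val a^-1%g *m e_ i).
have h2 := herm_Sp a^-1%g (e_ j) (e_ i); have h3 := herm_Sp a^-1%g (e_ i) (e_ j).
have h4 := qabs_hermC (sp_val a^-1%g *m e_ j) (sp_val h *m (sp_val a^-1%g *m e_ j)).
by rewrite h1 h2 h3 h4 !herm_conj_axis.
Qed.

Lemma qabs_cross_axis2 a h i j :
  qabs (cross_ratio (Sp_act h (projpt (sp_val a^-1%g *m e_ i)))
    (projpt (sp_val a^-1%g *m e_ i)) (projpt (sp_val a^-1%g *m e_ j))
    (Sp_act h (projpt (sp_val a^-1%g *m e_ j)))) =
  qabs (herm (e_ j) (sp_val (a * h * a^-1)%g *m e_ i)) * (qabs (herm (e_ j) (e_ i)))^-1 *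
    qabs (herm (e_ i) (sp_val (a * h * a^-1)%g *m e_ j)) * (qabs (herm (e_ j) (e_ i)))^-1.
Proof.
rewrite !Sp_act_projpt qabs_cross_ratio.
have h1 := herm_Sp h (sp_val a^-1%g *m e_ j) (sp_val a^-1%g *m e_ i).
have h2 := herm_Sp a^-1%g (e_ j) (e_ i).
have h4 := qabs_hermC (sp_val a^-1%g *m e_ i) (sp_val h *m (sp_val a^-1%g *m e_ j)).
by rewrite h1 h2 h4 !herm_conj_axis.
Qed.

Lemma qabs_herm_axis : qabs (herm (e_ N) (e_ X)) = 1 /\ qabs (herm (e_ X) (e_ N)) = 1.
Proof. by rewrite qabs_herm_pen qabs_herm_max !mxE !eqxx qabs1. Qed.

Lemma unit_quotients (s t A B C D : R) : A = s -> B = 1 -> C = t -> D = 1 ->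
  A * B^-1 * C * D^-1 = s * t.
Proof. by move=> -> -> -> ->; rewrite invr1 !mulr1. Qed.

Lemma qabs_herm_corner y :
  [/\ qabs (herm (e_ N) (sp_val y *m e_ N)) = corner_c y,
      qabs (herm (e_ N) (sp_val y *m e_ X)) = corner_d y,
      qabs (herm (e_ X) (sp_val y *m e_ N)) = corner_a y &
      qabs (herm (e_ X) (sp_val y *m e_ X)) = corner_b y].
Proof.
have E i j := congr1 (@qabs R) (mul_delta_cE (sp_val y) i j).
split; [exact: (etrans (qabs_herm_pen _) (E X N))|exact: (etrans (qabs_herm_pen _) (E X X))
       |exact: (etrans (qabs_herm_max _) (E N N))|exact: (etrans (qabs_herm_max _) (E N X))].
Qed.

(** Both orders of the ends are treated, because [fixpts g = [set u; v]] does not tell which of [u]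
    and [v] is which end. Exchanging them exchanges a with d and b with c, and leaves |ad| and |bc|
    unchanged. *)
Lemma sqrt_cross_axis a h (u := projpt (sp_val a^-1%g *m e_ N))
    (v := projpt (sp_val a^-1%g *m e_ X)) :
  [/\ Num.sqrt (qabs (cross_ratio (Sp_act h u) v u (Sp_act h v))) = rt_bc (a * h * a^-1)%g,
      Num.sqrt (qabs (cross_ratio (Sp_act h u) u v (Sp_act h v))) = rt_ad (a * h * a^-1)%g,
      Num.sqrt (qabs (cross_ratio (Sp_act h v) u v (Sp_act h u))) = rt_bc (a * h * a^-1)%g &
      Num.sqrt (qabs (cross_ratio (Sp_act h v) v u (Sp_act h u))) = rt_ad (a * h * a^-1)%g].
Proof.
have [h1 h2] := qabs_herm_axis; have [k1 k2 k3 k4] := qabs_herm_corner (a * h * a^-1)%g.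
split; apply: (congr1 Num.sqrt).
- exact: (etrans (qabs_cross_axis1 a h N X) (etrans (unit_quotients k1 h1 k4 h2) (mulrC _ _))).
- exact: (etrans (qabs_cross_axis2 a h N X) (unit_quotients k3 h2 k2 h2)).
- exact: (etrans (qabs_cross_axis1 a h X N) (unit_quotients k4 h2 k1 h1)).
- exact: (etrans (qabs_cross_axis2 a h X N) (etrans (unit_quotients k2 h1 k3 h1) (mulrC _ _))).
Qed.

Lemma Mg_ge0 g : 0 <= Mg g.
Proof. by rewrite !addr_ge0 ?qabs_ge0// mulr_ge0// bigmax_ge_id. Qed.

(* Without a diagonal form [eigs g] is [0], which makes [Mg g] at least 2. *)
Lemma Mg_diag_form g : Mg g < 1 -> diag_form g (eigs g).
Proof.
move=> Mg1; have [[l gl]|ngl] := pselect (exists l, diag_form g l).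
  exact: (@xgetI _ 0 [set l | diag_form g l] l gl).
have E : eigs g = 0 by apply: xgetPN => l gl; apply: ngl; exists l.
move: Mg1; rewrite /Mg E.
rewrite !mxE sub0r qabsN qabs1.
have d0 : 0 <= delta g by rewrite bigmax_ge_id.
lra.
Qed.

Lemma elementary_of_discrete g h (u v : set V) :
  fixpts g = [set u; v] ->
  Mg g * (1 + Num.sqrt (qabs (cross_ratio (Sp_act h u) v u (Sp_act h v)))) < 1 \/
  Mg g * (1 + Num.sqrt (qabs (cross_ratio (Sp_act h u) u v (Sp_act h v)))) < 1 ->
  discrete (gen2 g h) -> elementary (gen2 g h).
Proof.
move=> guv small dG.
(* Through [Mg_diag_form] this bound guarantees that [eigs g] is an actual diagonal form and not the
   default 0. *)
have Mg1 : Mg g < 1.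
  have k s : Mg g * (1 + Num.sqrt s) < 1 -> Mg g < 1.
    apply: le_lt_trans; rewrite ler_peMr ?Mg_ge0// lerDl; exact: sqrtr_ge0.
  by case: small; exact: k.
have [[a Dl] l1 lN1 lNX] := Mg_diag_form Mg1.
set l := eigs g in Dl l1 lN1 lNX.
have [gb gc] := preserves_diag Dl.
have EN : fixpts g (projpt (sp_val a^-1%g *m e_ N)).
  by split; [right; apply: bdry_axis; rewrite eqxx|exact: fixes_axis_pen].
have EX : fixpts g (projpt (sp_val a^-1%g *m e_ X)).
  by split; [right; apply: bdry_axis; rewrite eqxx orbT|exact: fixes_axis_max].
have NX := @axis_ends_neq R p a.
have small' : Mg g * (1 + rt_bc (a * h * a^-1)%g) < 1 \/
    Mg g * (1 + rt_ad (a * h * a^-1)%g) < 1.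
  have [c1 c2 c3 c4] := sqrt_cross_axis a h.
  rewrite guv in EN EX; case: EN EX => /= EN [] /= EX.
  - by case: NX; rewrite EN EX.
  - by rewrite -c1 -c2 EN EX.
  - by rewrite -c3 -c4 EN EX.
  - by case: NX; rewrite EN EX.
have r1 : qabs (l 0 N) * qabs (l 0 X) = 1.
  by rewrite -(qabs_conj (l 0 N)) -qabsM lNX qabs1.
have r0 : 0 < qabs (l 0 N).
  rewrite lt_neqAle qabs_ge0 andbT eq_sym; apply: contra_eq_neq r1 => ->.
  by rewrite mul0r eq_sym oner_neq0.
have lX : qabs (l 0 X) = (qabs (l 0 N))^-1.
  by apply: (mulfI (lt0r_neq0 r0)); rewrite r1 mulfV// gt_eqF.
apply: (@preserves_elementary a); apply: gen2_preserves; first by left.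
have rn1 : qabs (l 0 N) != 1 by exact/eqP.
have ld (i : 'I_p.+2) : (i < p)%N -> qabs (l 0 i - 1) <= delta g.
  by move=> ip; exact: (le_bigmax_cond _ (fun i : 'I_p.+2 => qabs (l 0 i - 1))).
have d0 : 0 <= delta g by exact: bigmax_ge_id.
exact: (preserves_of_discrete (@gen2_group g h) dG (@gen2_l g h) (@gen2_r g h) Dl l1
  (erefl (qabs (l 0 N))) lX r0 rn1 ld d0 (erefl (Mg g)) small').
Qed.

End Joergensen.

Unset Implicit Arguments.
Set Strict Implicit.
Set Printing Implicit Defensive.

Theorem theorem1p1 (R : realType) (p : nat) (g h : Sp R p)
    (u v : set 'cV[quat R]_p.+2) :
  loxodromic g -> bdry u -> bdry v -> fixpts g = [set u; v] ->
  Mg g * (1 + Num.sqrt (qabs (cross_ratio (Sp_act h u) v u (Sp_act h v)))) < 1 \/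
  Mg g * (1 + Num.sqrt (qabs (cross_ratio (Sp_act h u) u v (Sp_act h v)))) < 1 ->
  elementary (gen2 g h) \/ ~ discrete (gen2 g h).
Proof.
move=> _ _ _ guv small; have [dG|ndG] := pselect (discrete (gen2 g h)).
  by left; exact: elementary_of_discrete guv small dG.
by right.
Qed.
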